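(* Let $n\ge 4$. In the bigraded cohomology algebra of the ordered configuration space $F(\mathbb{C}P^1,n)$ the nonzero bigraded components are exactly $H_q^q$ and $H_{q+1}^{q+3}$ for $q=0,1,\dots,n-3$, and $$H_q^q\cong H_{q+1}^{q+3}\qquad (q=0,1,\dots,n-3)$$ as $\mathbb{Q}$-vector spaces. The two-variable Poincaré polynomial is $$P_{F(\mathbb{C}P^1,n)}(t,s)=(1+st^3)(1+2st)(1+3st)\cdots(1+(n-2)st).$$
   Context: $F(X,n)=\{(x_1,\dots,x_n)\in X^n\mid x_i\ne x_j\text{ for }i\ne j\}$. Cohomology is with rational coefficients, $H_q^k=H_q^k(F(\mathbb{C}P^1,n))$ denotes the cohomology at $E_q^k$ of the Kriz model $E(X,n)$ for $X=\mathbb{C}P^1$ (a rational model of $F(X,n)$), and $P_{F(X,n)}(t,s)=\sum_{k,q\ge0}(\dim H_q^k)t^ks^q$. The Kriz model for $X=\mathbb{C}P^1$ (complex dimension $m=1$): let $w\in H^2(X)$ be the fundamental class and $\Delta=w\otimes1+1\otimes w\in H^*(X)\otimes H^*(X)\cong H^*(X^2)$ the class of the diagonal; $p_i^*:H^*(X)\to H^*(X^n)$ and $p_{ij}^*:H^*(X^2)\to H^*(X^n)$ are the pullbacks along the projections to the $i$-th, resp. $(i,j)$-th, factors. $E(X,n)$ is the graded-commutative algebra obtained from the exterior algebra with generators $G_{ij}$ ($1\le i\ne j\le n$) of degree $2m-1=1$ and coefficients in $H^*(X)^{\otimes n}$, modulo the relations $G_{ji}=G_{ij}$; $p_j^*(x)G_{ij}=p_i^*(x)G_{ij}$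 for $i<j$, $x\in H^*(X)$; $G_{ik}G_{jk}=G_{ij}G_{jk}-G_{ij}G_{ik}$ for $i<j<k$. The differential is the derivation with $d|_{H^*(X)^{\otimes n}}=0$, $d(G_{ij})=p_{ij}^*(\Delta)$. In $E(X,n)=\bigoplus_{k,q}E_q^k$ the lower degree $q$ is the number of generators $G_{ij}$, the upper degree $k$ is the total degree, and $d:E_q^k\to E_{q-1}^{k+1}$. *)

(* Defs.v *)
From HB Require Import structures.
From mathcomp Require Import all_boot all_order all_algebra falgebra ring.

Set Implicit Arguments.
Unset Strict Implicit.
Unset Printing Implicit Defensive.

Import GRing.Theory.
Local Open Scope ring_scope.

Section GradedCommutative.
Variables I J : finType.

(* The graded-commutative Q-algebra on even generators x_i (i : I) with
   x_i^2 = 0 and odd generators y_j (j : J), that is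
   Q[x_i]/(x_i^2) (x) Lambda(y_j). A function on {set I + J} gives the
   coordinates in the basis of squarefree monomials; in each monomial the y_j
   are multiplied in increasing order of enum_rank. *)
Definition gcalg : Type := {ffun {set I + J} -> rat^o}.
HB.instance Definition _ := Vector.on gcalg.

Definition mon (S : {set I + J}) : gcalg := [ffun T => (T == S)%:R].

Definition swap (a b : I + J) : rat :=
  match a, b with
  | inr i, inr j => (-1) ^+ (enum_rank j < enum_rank i)
  | _, _ => 1
  end.

(* The Koszul sign of sorting the product of the monomials S and T. *)
Definition sgn (S T : {set I + J}) : rat := \prod_(a in S) \prod_(b in T) swap a b.

Definition monM (S T : {set I + J}) : gcalg :=
  if [disjoint S & T] then sgn S T *: mon (S :|: T) else 0.

Definition gcone : gcalg := mon set0.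
Definition gcmul (x y : gcalg) : gcalg :=
  \sum_S \sum_T (x S * y T) *: monM S T.

Lemma gcE (x : gcalg) : x = \sum_S x S *: mon S.
Proof.
apply/ffunP => T; rewrite sum_ffunE (bigD1 T) //= !ffunE eqxx big1 => [|S ST].
  by rewrite addr0 /GRing.scale /= mulr1.
by rewrite !ffunE eq_sym (negPf ST) scaler0.
Qed.

Lemma gcmul_linl y : linear (gcmul^~ y).
Proof.
move=> a x x'; rewrite /gcmul scaler_sumr -big_split; apply: eq_bigr => S _ /=.
rewrite scaler_sumr -big_split; apply: eq_bigr => T _ /=.
by rewrite !ffunE mulrDl scalerDl scalerA mulrA.
Qed.

Lemma gcmul_linr x : linear (gcmul x).
Proof.
move=> a y y'; rewrite /gcmul scaler_sumr -big_split; apply: eq_bigr => S _ /=.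
rewrite scaler_sumr -big_split; apply: eq_bigr => T _ /=.
by rewrite !ffunE mulrDr scalerDl scalerA [in LHS]mulrCA.
Qed.

Lemma monE S T : mon S T = (T == S)%:R.
Proof. by rewrite ffunE. Qed.

Lemma gcmul_mon S T : gcmul (mon S) (mon T) = monM S T.
Proof.
rewrite /gcmul (big_only1 S) => // [|S' /negPf S'S _]; last first.
  by apply: big1 => T' _; rewrite monE S'S mul0r scale0r.
rewrite (big_only1 T) => // [|T' /negPf T'T _]; last first.
  by rewrite [mon T T']monE T'T mulr0 scale0r.
by rewrite !monE !eqxx mulr1 scale1r.
Qed.

Lemma gcalg_ind (P : gcalg -> Prop) :
  (forall a x y, P x -> P y -> P (a *: x + y)) -> P 0 ->
  (forall S, P (mon S)) -> forall x, P x.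
Proof.
move=> PD P0 Pm x; rewrite (gcE x); elim: (index_enum _) => [|S s IH].
  by rewrite big_nil.
by rewrite big_cons; apply: PD.
Qed.

Lemma sgnUl (S S' T : {set I + J}) :
  [disjoint S & S'] -> sgn (S :|: S') T = sgn S T * sgn S' T.
Proof.
by move=> SS'; rewrite /sgn -bigU //; apply: eq_bigl => a; rewrite !inE.
Qed.

Lemma sgnUr (S T T' : {set I + J}) :
  [disjoint T & T'] -> sgn S (T :|: T') = sgn S T * sgn S T'.
Proof.
move=> TT'; rewrite /sgn -big_split /=; apply: eq_bigr => a _.
by rewrite -bigU //; apply: eq_bigl => b; rewrite !inE.
Qed.

Lemma gcmulZl a x y : gcmul (a *: x) y = a *: gcmul x y.
Proof.
have := gcmul_linl y a x 0; rewrite addr0 => ->.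
have := gcmul_linl y (-1) 0 0; rewrite scaler0 addr0 scaleN1r addNr => ->.
by rewrite addr0.
Qed.

Lemma gcmulZr a x y : gcmul x (a *: y) = a *: gcmul x y.
Proof.
have := gcmul_linr x a y 0; rewrite addr0 => ->.
have := gcmul_linr x (-1) 0 0; rewrite scaler0 addr0 scaleN1r addNr => ->.
by rewrite addr0.
Qed.

Lemma gcmul0x y : gcmul 0 y = 0.
Proof. by have := gcmulZl 0 0 y; rewrite !scale0r. Qed.

Lemma gcmulx0 y : gcmul y 0 = 0.
Proof. by have := gcmulZr 0 y 0; rewrite !scale0r. Qed.

Lemma disjointsUr (S T U : {set I + J}) :
  [disjoint S & T :|: U] = [disjoint S & T] && [disjoint S & U].
Proof. by rewrite disjoints_subset setCU subsetI -!disjoints_subset. Qed.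

Lemma disjointsUl (S T U : {set I + J}) :
  [disjoint T :|: U & S] = [disjoint T & S] && [disjoint U & S].
Proof. by rewrite disjoint_sym disjointsUr !(disjoint_sym S). Qed.

Lemma sgn0l T : sgn set0 T = 1.
Proof. by rewrite /sgn big_set0. Qed.
Lemma sgn0r S : sgn S set0 = 1.
Proof. by rewrite /sgn big1 // => a _; rewrite big_set0. Qed.

Fact gcmulA : associative gcmul.
Proof.
move=> x y z; elim/gcalg_ind: x => [a x x' IH IH'||S].
- by rewrite !gcmul_linl IH IH'.
- by rewrite !gcmul0x.
elim/gcalg_ind: y => [a y y' IH IH'||T].
- by rewrite gcmul_linl !gcmul_linr gcmul_linl IH IH'.
- by rewrite gcmul0x gcmulx0 gcmul0x.
elim/gcalg_ind: z => [a z z' IH IH'||U].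
- by rewrite !gcmul_linr IH IH'.
- by rewrite !gcmulx0.
rewrite !gcmul_mon /monM; case: (boolP [disjoint S & T]) => ST; last first.
  rewrite gcmul0x; case: ifP => TU; last by rewrite gcmulx0.
  by rewrite gcmulZr gcmul_mon /monM disjointsUr (negPf ST) scaler0.
case: (boolP [disjoint T & U]) => TU; last first.
  by rewrite gcmulx0 gcmulZl gcmul_mon /monM disjointsUl (negPf TU) andbF scaler0.
rewrite gcmulZr gcmulZl !gcmul_mon /monM disjointsUr disjointsUl ST TU andbT /=.
case: ifP => SU; last by rewrite !scaler0.
rewrite !scalerA sgnUr // sgnUl // setUA; congr (_ *: _).
by rewrite mulrC mulrA.
Qed.

Fact gcmul1x : left_id gcone gcmul.
Proof.
elim/gcalg_ind => [a x x' IH IH'||S]; first by rewrite gcmul_linr IH IH'.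
  by rewrite gcmulx0.
by rewrite gcmul_mon /monM disjoints_subset sub0set sgn0l scale1r set0U.
Qed.

Fact gcmulx1 : right_id gcone gcmul.
Proof.
elim/gcalg_ind => [a x x' IH IH'||S]; first by rewrite gcmul_linl IH IH'.
  by rewrite gcmul0x.
by rewrite gcmul_mon /monM disjoint_sym disjoints_subset sub0set sgn0r scale1r setU0.
Qed.

Fact gcmulDl : left_distributive gcmul +%R.
Proof. by move=> x x' y; have := gcmul_linl y 1 x x'; rewrite !scale1r. Qed.
Fact gcmulDr : right_distributive gcmul +%R.
Proof. by move=> y x x'; have := gcmul_linr y 1 x x'; rewrite !scale1r. Qed.
Fact gcone_neq0 : gcone != 0.
Proof.
apply/eqP => /ffunP/(_ set0); rewrite !ffunE eqxx => /eqP.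
by rewrite oner_eq0.
Qed.

HB.instance Definition _ := GRing.Zmodule_isNzRing.Build gcalg
  gcmulA gcmul1x gcmulx1 gcmulDl gcmulDr gcone_neq0.
HB.instance Definition _ := GRing.Lmodule_isLalgebra.Build rat gcalg
  (fun a x y => esym (gcmulZl a x y)).
HB.instance Definition _ := GRing.Lalgebra_isAlgebra.Build rat gcalg
  (fun a x y => esym (gcmulZr a x y)).
HB.instance Definition _ := Algebra_isFalgebra.Build rat gcalg.

Lemma gcM_mon S T : mon S * mon T = monM S T.
Proof. exact: gcmul_mon. Qed.

Definition gen (a : I + J) : gcalg := mon [set a].
Definition evx (i : I) : gcalg := gen (inl i).
Definition ody (j : J) : gcalg := gen (inr j).

Lemma sgn_neq0 S T : sgn S T != 0.
Proof.
apply/prodf_neq0 => a _; apply/prodf_neq0 => b _; case: a b => [i|j] [i'|j'] //=.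
by rewrite signr_eq0.
Qed.

Lemma sgn11 a b : sgn [set a] [set b] = swap a b.
Proof. by rewrite /sgn !big_set1. Qed.

Lemma genM_mon (a : I + J) (S : {set I + J}) :
  gen a * mon S = if a \in S then 0 else sgn [set a] S *: mon (a |: S).
Proof. by rewrite gcM_mon /monM disjoints1 if_neg. Qed.

Lemma mon_genM (a : I + J) (S : {set I + J}) : a \in S ->
  mon S = (sgn [set a] (S :\ a))^-1 *: (gen a * mon (S :\ a)).
Proof.
move=> aS; rewrite genM_mon setD11 setD1K // scalerA mulVf ?scale1r //.
exact: sgn_neq0.
Qed.

Lemma gcalg_genind (P : gcalg -> Prop) :
  (forall a x y, P x -> P y -> P (a *: x + y)) -> P 0 -> P 1 ->
  (forall i u, P u -> P (evx i * u)) -> (forall j u, P u -> P (ody j * u)) ->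
  forall u, P u.
Proof.
move=> PD P0 P1 Px Py; apply: gcalg_ind => // S.
have [m] := ubnP #|S|; elim: m S => // m IH S /ltnSE Sm.
have [->|[a aS]] := set_0Vmem S; first exact: P1.
have PS' : P (mon (S :\ a)) by apply: IH; rewrite (cardsD1 a S) aS in Sm.
rewrite (mon_genM aS) -[_ *: _]addr0; apply: PD => //.
by case: a {aS} PS' => [i|j] PS'; [apply: Px|apply: Py].
Qed.

Lemma swapC (a b : I + J) : a != b ->
  swap a b * swap b a = if (a, b) is (inr _, inr _) then -1 else 1.
Proof.
case: a b => [i|j] [i'|j'] //=; rewrite ?mulr1 // => jj'.
rewrite -signr_addb; case: ltngtP => // /ord_inj/enum_rank_inj jj.
by rewrite jj eqxx in jj'.
Qed.

Lemma genC (a b : I + J) :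
  gen a * gen b = (if (a, b) is (inr _, inr _) then -1 else 1) *: (gen b * gen a).
Proof.
rewrite /gen !genM_mon !inE [b == a]eq_sym; case: ifPn => [|ab].
  by rewrite scaler0.
rewrite !sgn11 setUC scalerA -(swapC ab) -[in RHS]mulrA.
suff -> : swap b a * swap b a = 1 by rewrite mulr1.
by case: a b {ab} => [i|j] [i'|j'] //=; rewrite ?mulr1 // -expr2 sqrr_sign.
Qed.

Lemma evx_sqr i : evx i * evx i = 0.
Proof. by rewrite genM_mon set11. Qed.

Lemma ody_sqr j : ody j * ody j = 0.
Proof. by rewrite genM_mon set11. Qed.

Lemma odyC i j : ody i * ody j = - (ody j * ody i).
Proof. by rewrite genC scaleN1r. Qed.

Lemma evx_central i u : evx i * u = u * evx i.
Proof.
elim/gcalg_genind: u => [a u v IHu IHv|||k u IH|k u IH].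
- by rewrite mulrDr mulrDl -scalerAr -scalerAl IHu IHv.
- by rewrite mulr0 mul0r.
- by rewrite mulr1 mul1r.
- by rewrite mulrA genC scale1r -!mulrA IH.
- by rewrite mulrA genC scale1r -!mulrA IH.
Qed.

End GradedCommutative.
Arguments evx {I J} i.
Arguments ody {I J} j.

Section Derivations.
Variables I J : finType.
Local Notation A := (gcalg I J).
Implicit Types (u v : A) (S : {set I + J}) (i : I) (j : J).

Definition odd_part S : {set J} := [set j | inr j \in S].
Definition even_part S : {set I} := [set i | inl i \in S].

(* Linear extension of a map given on monomials. *)
Definition extend_lin (f : {set I + J} -> A) u : A := \sum_S u S *: f S.

Fact extend_lin_is_linear f : linear (extend_lin f).
Proof.
move=> a u v; rewrite /extend_lin scaler_sumr -big_split; apply: eq_bigr => S _ /=.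
by rewrite !ffunE scalerDl scalerA.
Qed.
HB.instance Definition _ f := GRing.isLinear.Build rat A A *:%R (extend_lin f)
  (extend_lin_is_linear f).

Lemma extend_lin_mon f S : extend_lin f (mon S) = f S.
Proof.
rewrite /extend_lin (big_only1 S) => // [|T /negPf TS _].
  by rewrite monE eqxx scale1r.
by rewrite monE TS scale0r.
Qed.

(* The automorphism u |-> (-1)^|u| u. *)
Definition parity : 'End(A) :=
  linfun (extend_lin (fun S => (-1) ^+ #|odd_part S| *: mon S)).

(* The antiderivation d/dy_j. *)
Definition contract j : 'End(A) :=
  linfun (extend_lin (fun S => if inr j \in S
    then sgn [set inr j] (S :\ inr j) *: mon (S :\ inr j) else 0)).

(* For even (hence central) D j, this is the antiderivation with x_i |-> 0 and
   y_j |-> D j: see [deriv_of_leibniz], [deriv_of_evx] and [deriv_of_ody]. *)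
Definition deriv_of (D : J -> A) : 'End(A) :=
  \sum_j (amull (D j) \o contract j)%VF.

Lemma odd_part_evx i S : odd_part (inl i |: S) = odd_part S.
Proof. by apply/setP => j; rewrite !inE. Qed.

Lemma odd_part_ody j S : odd_part (inr j |: S) = j |: odd_part S.
Proof. by apply/setP => j'; rewrite !inE. Qed.

Lemma parity_mon S : parity (mon S) = (-1) ^+ #|odd_part S| *: mon S.
Proof. by rewrite lfunE /= extend_lin_mon. Qed.

Lemma contract_mon j S : contract j (mon S) =
  if inr j \in S then sgn [set inr j] (S :\ inr j) *: mon (S :\ inr j) else 0.
Proof. by rewrite lfunE /= extend_lin_mon. Qed.

Lemma parity1 : parity 1 = 1.
Proof. by rewrite parity_mon (_ : odd_part _ = set0) ?cards0 ?scale1r //; apply/setP => j; rewrite !inE. Qed.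

Lemma parity_evxM i u : parity (evx i * u) = evx i * parity u.
Proof.
elim/gcalg_ind: u => [a u v IHu IHv||S].
- by rewrite mulrDr -scalerAr !linearP /= IHu IHv mulrDr -scalerAr.
- by rewrite !(mulr0, linear0).
rewrite parity_mon -scalerAr genM_mon; case: ifP => iS.
  by rewrite linear0 scaler0.
by rewrite linearZ /= parity_mon odd_part_evx !scalerA mulrC.
Qed.

Lemma parity_odyM j u : parity (ody j * u) = - (ody j * parity u).
Proof.
elim/gcalg_ind: u => [a u v IHu IHv||S].
- by rewrite mulrDr -scalerAr !linearP /= IHu IHv mulrDr -scalerAr opprD scalerN.
- by rewrite !(mulr0, linear0) ?oppr0.
rewrite parity_mon -scalerAr genM_mon; case: ifP => jS.
  by rewrite linear0 scaler0 oppr0.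
rewrite linearZ /= parity_mon odd_part_ody cardsU1 inE jS exprS mulN1r.
by rewrite !scalerA mulrN mulrC scaleNr.
Qed.

Lemma parityM u v : parity (u * v) = parity u * parity v.
Proof.
elim/gcalg_genind: u => [a u u' IHu IHu'|||i u IH|j u IH].
- by rewrite mulrDl -scalerAl !linearP /= IHu IHu' /= mulrDl -scalerAl.
- by rewrite mul0r linear0 mul0r.
- by rewrite parity1 !mul1r.
- by rewrite -mulrA !parity_evxM IH mulrA.
- by rewrite -mulrA !parity_odyM IH mulrA mulNr.
Qed.

Lemma sgn_sqr S T : sgn S T * sgn S T = 1.
Proof.
rewrite /sgn -big_split big1 // => a _; rewrite -big_split big1 // => b _.
by case: a b => [i|j] [i'|j'] //=; rewrite ?mulr1 // -expr2 sqrr_sign.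
Qed.

Lemma contract1 j : contract j 1 = 0.
Proof. by rewrite contract_mon inE. Qed.

Lemma setU1D1 (T : finType) (a b : T) (B : {set T}) : a != b ->
  (a |: B) :\ b = a |: (B :\ b).
Proof. by move=> ab; apply/setP => c; rewrite !inE; case: eqP => // ->; rewrite eq_sym (negPf ab). Qed.

Lemma sgn1U1 (a b : I + J) S : b \notin S ->
  sgn [set a] (b |: S) = swap a b * sgn [set a] S.
Proof. by move=> bS; rewrite sgnUr ?disjoints1 // sgn11. Qed.

Lemma contract_evxM j i u : contract j (evx i * u) = evx i * contract j u.
Proof.
elim/gcalg_ind: u => [a u v IHu IHv||S].
- by rewrite mulrDr -scalerAr !linearP /= IHu IHv mulrDr -scalerAr.
- by rewrite !(mulr0, linear0).
rewrite contract_mon genM_mon; case: ifPn => iS.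
  rewrite linear0; case: ifP => jS; last by rewrite mulr0.
  by rewrite -scalerAr genM_mon !inE iS /= scaler0.
rewrite linearZ /= contract_mon !inE /=; case: ifPn => jS.
  rewrite -scalerAr genM_mon !inE (negPf iS) /= setU1D1 // sgn1U1 ?inE ?negb_and ?iS ?orbT //.
  rewrite -[in sgn [set inl i] S](setD1K jS) sgn1U1 ?setD11 //= !mul1r.
  by rewrite !scalerA mulrC.
by rewrite scaler0 mulr0.
Qed.

Lemma contract_odyM j k u :
  contract j (ody k * u) = (j == k)%:R *: u - ody k * contract j u.
Proof.
elim/gcalg_ind: u => [a u v IHu IHv||S].
- rewrite mulrDr -scalerAr !linearP /= IHu IHv mulrDr -scalerAr opprD.
  by rewrite scalerBr addrACA.
- by rewrite mulr0 !linear0 ?mulr0 ?scaler0 ?subrr.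
rewrite contract_mon genM_mon; have [<-|jk] := eqVneq j k.
  rewrite scale1r; case: ifPn => jS.
    rewrite linear0 -scalerAr genM_mon setD11 scalerA sgn_sqr scale1r.
    by rewrite setD1K // subrr.
  rewrite mulr0 subr0 linearZ /= contract_mon setU11 setU1K //.
  by rewrite scalerA sgn_sqr scale1r.
rewrite scale0r add0r; case: ifPn => kS.
  rewrite linear0; case: ifP => jS; last by rewrite mulr0 oppr0.
  rewrite -scalerAr genM_mon !inE kS andbT (inj_eq inr_inj) eq_sym jk.
  by rewrite scaler0 oppr0.
have kj : inr k != inr j :> I + J by rewrite (inj_eq inr_inj) eq_sym.
rewrite linearZ /= contract_mon !inE (inj_eq inr_inj) (negPf jk) /=.
case: ifPn => jS; last by rewrite scaler0 mulr0 oppr0.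
rewrite -scalerAr genM_mon !inE (negPf kS) andbF setU1D1 //.
rewrite sgn1U1 ?inE ?negb_and ?kS ?orbT //.
rewrite -[in sgn [set inr k] S](setD1K jS) sgn1U1 ?setD11 // !scalerA -scaleNr.
congr (_ *: _); rewrite mulrACA (swapC kj) mulN1r; congr (- _).
exact: mulrC.
Qed.

Lemma contractM j u v :
  contract j (u * v) = contract j u * v + parity u * contract j v.
Proof.
elim/gcalg_genind: u => [a u u' IHu IHu'|||i u IH|k u IH].
- rewrite mulrDl -scalerAl !linearP /= IHu IHu' /= !mulrDl -!scalerAl.
  by rewrite scalerDr addrACA.
- by rewrite mul0r !linear0 !mul0r addr0.
- by rewrite contract1 parity1 mul0r add0r !mul1r.
- by rewrite -mulrA !contract_evxM IH parity_evxM mulrDr !mulrA.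
rewrite -mulrA !contract_odyM IH parity_odyM mulrBl -scalerAl mulrDr opprD.
by rewrite mulNr !mulrA addrA.
Qed.

Lemma deriv_ofE D u : deriv_of D u = \sum_j D j * contract j u.
Proof. by rewrite sum_lfunE; apply: eq_bigr => j _; rewrite comp_lfunE lfunE. Qed.

Lemma deriv_of_leibniz D : (forall j u, D j * u = u * D j) ->
  forall u v, deriv_of D (u * v) = deriv_of D u * v + parity u * deriv_of D v.
Proof.
move=> DC u v; rewrite !deriv_ofE mulr_suml mulr_sumr -big_split.
apply: eq_bigr => j _ /=; rewrite contractM mulrDr mulrA; congr (_ + _).
by rewrite !mulrA DC.
Qed.

Lemma deriv_of_evx D i : deriv_of D (evx i) = 0.
Proof.
rewrite deriv_ofE big1 // => j _.
by rewrite -[evx i]mulr1 contract_evxM contract1 !mulr0.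
Qed.

Lemma deriv_of_ody D j : deriv_of D (ody j) = D j.
Proof.
have cE k : contract k (ody j) = (k == j)%:R.
  by rewrite -[ody j]mulr1 contract_odyM contract1 mulr0 subr0 scaler_nat.
rewrite deriv_ofE (big_only1 j) => // [|k /negPf kj _]; rewrite cE.
  by rewrite eqxx mulr1.
by rewrite kj mulr0.
Qed.

Lemma coef_gcM u v : (u * v) set0 = u set0 * v set0.
Proof.
have linE a (x y : A) : (a *: x + y) set0 = a * x set0 + y set0 by rewrite !ffunE.
have zeroE : (0 : A) set0 = 0 by rewrite ffunE.
elim/gcalg_ind: u => [a x y IHx IHy||S].
- by rewrite mulrDl -scalerAl !linE IHx IHy mulrDl mulrA.
- by rewrite mul0r zeroE mul0r.
elim/gcalg_ind: v => [a x y IHx IHy||T].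
- by rewrite mulrDr -scalerAr !linE IHx IHy mulrDr mulrCA.
- by rewrite mulr0 zeroE mulr0.
rewrite gcM_mon /monM !monE -natrM mulnb ![set0 == _]eq_sym -setU_eq0.
case: ifPn => [ST|nST]; last first.
  rewrite ffunE; case: eqP nST => // /eqP; rewrite setU_eq0 => /andP[/eqP-> _].
  by rewrite disjoints_subset sub0set.
rewrite ffunE monE eq_sym; case: eqP => [/eqP|_]; last by rewrite scaler0.
by rewrite setU_eq0 => /andP[/eqP-> _]; rewrite sgn0l scale1r.
Qed.
End Derivations.

Section Quotient.
Variables (K : fieldType) (V : vectType K).

(* The quotient V / U, carried by the complement U^C; [quot_pi U] is the
   canonical projection, i.e. the projection onto U^C along U. *)
Definition quotv (U : {vspace V}) : Type := subvs_of (U^C)%VS.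
HB.instance Definition _ (U : {vspace V}) := Vector.on (quotv U).

Variable U : {vspace V}.

Definition quot_pi : 'Hom(V, quotv U) :=
  (linfun (vsproj (U^C)%VS) \o daddv_pi (U^C)%VS U)%VF.

Definition quot_repr : 'Hom(quotv U, V) := linfun (@vsval _ _ (U^C)%VS).

Lemma quot_reprK x : quot_pi (quot_repr x) = x.
Proof.
have UCU : (U^C :&: U = 0)%VS by rewrite capvC capv_compl.
rewrite comp_lfunE !lfunE /= daddv_pi_id ?subvsP //; exact: vsvalK.
Qed.

Lemma lker_quot_pi : lker quot_pi = U.
Proof.
have UCU : (U^C :&: U = 0)%VS by rewrite capvC capv_compl.
apply/vspaceP => v; rewrite memv_ker comp_lfunE lfunE /=.
have vE : daddv_pi (U^C) U v + daddv_pi U (U^C) v = v.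
  by apply: daddv_pi_add => //; rewrite addvC addv_complf memvf.
rewrite -(inj_eq (@subvs_inj _ _ _)) linear0 vsprojK ?memv_pi //.
apply/eqP/idP => [v0|vU]; first by rewrite -vE v0 add0r memv_pi.
have : daddv_pi (U^C) U v \in (U^C :&: U)%VS.
  rewrite memv_cap memv_pi /=.
  by rewrite -[X in X \in U](addrK (daddv_pi U (U^C) v)) vE memvB ?memv_pi.
by rewrite UCU memv0 => /eqP.
Qed.

Lemma quot_pi_eq0 v : (quot_pi v == 0) = (v \in U).
Proof. by rewrite -memv_ker lker_quot_pi. Qed.

Lemma limg_quot_pi : limg quot_pi = fullv.
Proof.
apply/vspaceP => x; rewrite memvf; apply/memv_imgP.
by exists (quot_repr x); rewrite ?memvf ?quot_reprK.
Qed.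

Definition quot_end (f : 'End(V)) : 'End(quotv U) :=
  (quot_pi \o f \o quot_repr)%VF.

Lemma quot_endE f : (f @: U <= U)%VS -> forall v, quot_end f (quot_pi v) = quot_pi (f v).
Proof.
move=> fU v; have -> x : quot_end f x = quot_pi (f (quot_repr x)).
  by rewrite !comp_lfunE.
apply/eqP; rewrite -subr_eq0 -!linearB /= quot_pi_eq0.
apply: (subvP fU); apply: memv_img.
by rewrite -quot_pi_eq0 linearB /= quot_reprK subrr.
Qed.
End Quotient.

Section Kriz.
Variable n : nat.
Implicit Types i j k : 'I_n.

Definition edge : Type := {e : 'I_n * 'I_n | e.1 != e.2}.
HB.instance Definition _ := Finite.on edge.

(* H^*(CP^1)^{(x) n} (x) Lambda(G_ij): since H^*(CP^1) = Q[w]/(w^2), the tensor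
   power is Q[w_1, ..., w_n]/(w_i^2), where w_i = p_i^*(w). *)
Definition krizA : Type := gcalg 'I_n edge.
HB.instance Definition _ := Falgebra.on krizA.

Definition w i : krizA := evx i.

(* The value at i = j is a dummy. *)
Definition G i j : krizA :=
  if insub (i, j) : option edge is Some e then ody e else 0.

(* The second relation is only needed for x = w: it is linear in x, and trivial
   for x = 1. *)
Definition kriz_rel : {vspace krizA} :=
  (\sum_(i < n) \sum_(j < n | i != j) <[G j i - G i j]>
   + \sum_(i < n) \sum_(j < n | (i < j)%N) <[w j * G i j - w i * G i j]>
   + \sum_(i < n) \sum_(j < n | (i < j)%N) \sum_(k < n | (j < k)%N)
       <[G i k * G j k - (G i j * G j k - G i j * G i k)]>)%VS.

Definition kriz_ideal : {vspace krizA} := ({:krizA} * kriz_rel * {:krizA})%VS.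

(* p_ij^*(Delta), where Delta = w (x) 1 + 1 (x) w. *)
Definition diagonal i j : krizA := w i + w j.

Definition kriz_dA : 'End(krizA) :=
  deriv_of (fun e : edge => diagonal (val e).1 (val e).2).

Lemma kriz_dA_leibniz (u v : krizA) :
  kriz_dA (u * v) = kriz_dA u * v + parity 'I_n edge u * kriz_dA v.
Proof.
by apply: deriv_of_leibniz => e x; rewrite mulrDl mulrDr /w !evx_central.
Qed.

Lemma kriz_dA_w i : kriz_dA (w i) = 0.
Proof. exact: deriv_of_evx. Qed.

Lemma kriz_dA_G i j : i != j -> kriz_dA (G i j) = diagonal i j.
Proof.
move=> ij; rewrite /G; case: insubP => [e _ eE|]; last by rewrite /= ij.
by rewrite /kriz_dA deriv_of_ody eE.
Qed.

Lemma parityG i j : parity _ _ (G i j) = - G i j.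
Proof.
rewrite /G; case: insub => [e|]; last by rewrite linear0 oppr0.
by rewrite -[ody e]mulr1 parity_odyM parity1.
Qed.

Lemma parity_w i : parity _ _ (w i) = w i.
Proof. by rewrite -[w i]mulr1 parity_evxM parity1. Qed.

Lemma wC i (u : krizA) : w i * u = u * w i.
Proof. exact: evx_central. Qed.

Lemma w_sqr i : w i * w i = 0.
Proof. exact: evx_sqr. Qed.

Lemma GC i j k l : G i j * G k l = - (G k l * G i j).
Proof.
rewrite /G; case: insub => [e|]; case: insub => [f|]; rewrite ?(mul0r, mulr0, oppr0) //.
exact: odyC.
Qed.

Lemma kriz_relP (U : {vspace krizA}) :
  (forall i j, i != j -> G j i - G i j \in U) ->
  (forall i j, (i < j)%N -> w j * G i j - w i * G i j \in U) ->
  (forall i j k, (i < j)%N -> (j < k)%N ->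
     G i k * G j k - (G i j * G j k - G i j * G i k) \in U) ->
  (kriz_rel <= U)%VS.
Proof.
move=> U1 U2 U3; rewrite /kriz_rel !subv_add -andbA; apply/and3P; split.
- by do 2![apply/subv_sumP => ? ?]; rewrite -memvE; apply: U1.
- by do 2![apply/subv_sumP => ? ?]; rewrite -memvE; apply: U2.
- by do 3![apply/subv_sumP => ? ?]; rewrite -memvE; apply: U3.
Qed.

Lemma kriz_rel1 i j : i != j -> G j i - G i j \in kriz_rel.
Proof.
move=> ij; rewrite memvE /kriz_rel -addvA; apply: subv_trans (addvSl _ _).
by apply: (sumv_sup i) => //; apply: (sumv_sup j).
Qed.

Lemma kriz_rel2 i j : (i < j)%N -> w j * G i j - w i * G i j \in kriz_rel.
Proof.
move=> ij; rewrite memvE /kriz_rel; apply: subv_trans (addvSl _ _).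
apply: subv_trans (addvSr _ _).
by apply: (sumv_sup i) => //; apply: (sumv_sup j).
Qed.

Lemma kriz_rel3 i j k : (i < j)%N -> (j < k)%N ->
  G i k * G j k - (G i j * G j k - G i j * G i k) \in kriz_rel.
Proof.
move=> ij jk; rewrite memvE /kriz_rel; apply: subv_trans (addvSr _ _).
by apply: (sumv_sup i) => //; apply: (sumv_sup j) => //; apply: (sumv_sup k).
Qed.

Lemma kriz_rel_sub : (kriz_rel <= kriz_ideal)%VS.
Proof.
apply/subvP => r rR; rewrite -[r]mulr1 -[r]mul1r; apply: memv_mul; rewrite ?memvf //.
by apply: memv_mul; rewrite ?memvf.
Qed.

Lemma kriz_idealMl (a u : krizA) : u \in kriz_ideal -> a * u \in kriz_ideal.
Proof.
move=> uI; have: a * u \in ({:krizA} * kriz_ideal)%VS by rewrite memv_mul ?memvf.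
apply: subvP; rewrite /kriz_ideal !prodvA; do 2!apply: prodvSl; exact: subvf.
Qed.

Lemma kriz_idealMr (a u : krizA) : u \in kriz_ideal -> u * a \in kriz_ideal.
Proof.
move=> uI; have: u * a \in (kriz_ideal * {:krizA})%VS by rewrite memv_mul ?memvf.
apply: subvP; rewrite /kriz_ideal -prodvA; apply: prodvSr; exact: subvf.
Qed.

Lemma kriz_idealP (U : {vspace krizA}) :
  (forall a r b, r \in kriz_rel -> a * r * b \in U) -> (kriz_ideal <= U)%VS.
Proof.
move=> Ur; apply/prodvP => x b xR _.
suff: (({:krizA} * kriz_rel)%VS <= amulr b @^-1: U)%VS.
  by move=> /subvP/(_ _ xR); rewrite -memv_preim lfunE.
by apply/prodvP => a r _ rR; rewrite -memv_preim lfunE /=; apply: Ur.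
Qed.

Lemma parity_kriz_rel r : r \in kriz_rel -> parity _ _ r \in kriz_rel.
Proof.
rewrite memv_preim; apply: subvP r; apply: kriz_relP => [i j ij|i j ij|i j k ij jk];
  rewrite -memv_preim.
- by rewrite linearB /= !parityG -opprB opprK addrC memvN kriz_rel1.
- by rewrite linearB /= !parityM !parityG !parity_w !mulrN -opprD memvN kriz_rel2.
- by rewrite linearB [X in _ - X]linearB /= !parityM !parityG !mulrNN kriz_rel3.
Qed.

Lemma kriz_dA_rel r : r \in kriz_rel -> kriz_dA r \in kriz_ideal.
Proof.
have neq i j : (i < j)%N -> i != j by move=> ij; rewrite neq_ltn ij.
have wG i j : (i < j)%N -> (w j - w i) * G i j \in kriz_ideal.
  by move=> ij; rewrite mulrBl; apply: (subvP kriz_rel_sub); apply: kriz_rel2.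
rewrite memv_preim; apply: subvP r; apply: kriz_relP => [i j ij|i j ij|i j k ij jk];
  rewrite -memv_preim.
- rewrite linearB /= !kriz_dA_G // 1?eq_sym // /diagonal [w j + _]addrC subrr.
  exact: mem0v.
- rewrite linearB /= !kriz_dA_leibniz !kriz_dA_w !mul0r !add0r !parity_w.
  rewrite !kriz_dA_G ?neq // /diagonal !mulrDr !w_sqr addr0 add0r [w i * _]wC.
  by rewrite subrr mem0v.
have ik := ltn_trans ij jk.
rewrite linearB [X in _ - X]linearB /= !kriz_dA_leibniz !parityG !kriz_dA_G ?neq //.
rewrite /diagonal !mulNr !mulrDr -!wC !mulrDl.
set x := (X in X \in _); suff -> : x =
    (w k - w j) * G j k - (w k - w i) * G i k + (w j - w i) * G i j.
  by rewrite memvD ?memvB ?wG.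
rewrite {}/x !mulrBl.
do 9![move: (w _ * G _ _) => ?].
by apply/ffunP => S; rewrite !ffunE; ring.
Qed.

Lemma kriz_dA_ideal : (kriz_dA @: kriz_ideal <= kriz_ideal)%VS.
Proof.
apply/subvP => _ /memv_imgP[u uI ->]; rewrite memv_preim.
apply: (subvP (kriz_idealP _)) uI => a r b rR; rewrite -memv_preim.
have rI := subvP kriz_rel_sub _ rR.
have prI := subvP kriz_rel_sub _ (parity_kriz_rel rR).
rewrite !kriz_dA_leibniz parityM; apply: memvD; apply: kriz_idealMr.
  by apply: memvD; apply: kriz_idealMl => //; apply: kriz_dA_rel.
exact: kriz_idealMl.
Qed.

Lemma kriz_dA_sqr (u : krizA) : kriz_dA (kriz_dA u) = 0.
Proof.
elim/gcalg_genind: u => [a u v IHu IHv|||i u IH|e u IH].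
- by rewrite !linearP /= IHu IHv scaler0 addr0.
- by rewrite !linear0.
- rewrite [X in kriz_dA X]deriv_ofE big1 ?linear0 // => e _.
  by rewrite contract1 mulr0.
- rewrite kriz_dA_leibniz deriv_of_evx mul0r add0r parity_w.
  by rewrite kriz_dA_leibniz deriv_of_evx mul0r add0r IH mulr0.
have dG : kriz_dA (ody e) = diagonal (val e).1 (val e).2 by exact: deriv_of_ody.
have pG : parity 'I_n edge (ody e) = - ody e.
  by rewrite -[ody e]mulr1 parity_odyM parity1.
rewrite kriz_dA_leibniz pG mulNr linearB /= !kriz_dA_leibniz pG dG IH.
by rewrite mulr0 addr0 /diagonal linearD /= !kriz_dA_w addr0 mul0r add0r linearD /= !parity_w subrr.
Qed.

Lemma kriz_ideal_aug (u : krizA) : u \in kriz_ideal -> u set0 = 0.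
Proof.
pose aug : 'End(krizA) := linfun (extend_lin (fun S => (S == set0)%:R : krizA)).
have augE (v : krizA) : aug v = v set0 *: 1.
  rewrite lfunE /= /extend_lin (big_only1 set0) ?eqxx // => S /negPf-> _.
  by rewrite scaler0.
have augP (v : krizA) : (v \in lker aug) = (v set0 == 0).
  by rewrite memv_ker augE scaler_eq0 oner_eq0 orbF.
have G0 i j : G i j set0 = 0.
  rewrite /G; case: insub => [e|]; rewrite ffunE // eq_sym; case: eqP => // /setP/(_ (inr e)).
  by rewrite !inE eqxx.
move=> uI; apply/eqP; rewrite -augP; apply: (subvP (kriz_idealP _)) uI => a r b rR.
rewrite augP !coef_gcM; suff -> : r set0 = 0 by rewrite mulr0 mul0r.
apply/eqP; rewrite -augP; apply: subvP r rR; apply: kriz_relP => [i j _|i j _|i j k _ _].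
- by rewrite memvB ?augP ?G0.
- by rewrite memvB ?augP ?coef_gcM ?G0 ?mulr0.
- by rewrite !memvB ?augP ?coef_gcM ?G0 ?mulr0.
Qed.

Definition krizE : Type := quotv kriz_ideal.
HB.instance Definition _ := Vector.on krizE.

Definition krizE_pi : 'Hom(krizA, krizE) := quot_pi kriz_ideal.
Definition krizE_repr : 'Hom(krizE, krizA) := quot_repr kriz_ideal.
Definition krizE_one : krizE := krizE_pi 1.
Definition krizE_mul (x y : krizE) : krizE :=
  krizE_pi (krizE_repr x * krizE_repr y).

Lemma krizE_reprK (x : krizE) : krizE_pi (krizE_repr x) = x.
Proof. exact: quot_reprK. Qed.

Lemma krizE_piP (u v : krizA) :
  reflect (krizE_pi u = krizE_pi v) (u - v \in kriz_ideal).
Proof. by rewrite -quot_pi_eq0 linearB subr_eq0; apply: eqP. Qed.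

Lemma krizE_mul_pi (u v : krizA) :
  krizE_mul (krizE_pi u) (krizE_pi v) = krizE_pi (u * v).
Proof.
have rI x : krizE_repr (krizE_pi x) - x \in kriz_ideal.
  by apply/krizE_piP; rewrite krizE_reprK.
apply/krizE_piP; set u' := krizE_repr _; set v' := krizE_repr _.
have -> : u' * v' - u * v = (u' - u) * v' + u * (v' - v).
  by rewrite mulrBl mulrBr addrA subrK.
by apply: memvD; [apply: kriz_idealMr | apply: kriz_idealMl]; apply: rI.
Qed.

Fact krizE_mulA : associative krizE_mul.
Proof.
move=> x y z; rewrite -(krizE_reprK x) -(krizE_reprK y) -(krizE_reprK z).
by rewrite !krizE_mul_pi mulrA.
Qed.

Fact krizE_mul1x : left_id krizE_one krizE_mul.
Proof. by move=> x; rewrite -(krizE_reprK x) krizE_mul_pi mul1r. Qed.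

Fact krizE_mulx1 : right_id krizE_one krizE_mul.
Proof. by move=> x; rewrite -(krizE_reprK x) krizE_mul_pi mulr1. Qed.

Fact krizE_mulDl : left_distributive krizE_mul +%R.
Proof.
move=> x y z; rewrite -(krizE_reprK x) -(krizE_reprK y) -(krizE_reprK z).
by rewrite -linearD !krizE_mul_pi mulrDl linearD.
Qed.

Fact krizE_mulDr : right_distributive krizE_mul +%R.
Proof.
move=> x y z; rewrite -(krizE_reprK x) -(krizE_reprK y) -(krizE_reprK z).
by rewrite -linearD !krizE_mul_pi mulrDr linearD.
Qed.

Fact krizE_one_neq0 : krizE_one != 0.
Proof.
rewrite quot_pi_eq0; apply/negP => /kriz_ideal_aug.
by rewrite ffunE eqxx => /eqP; rewrite oner_eq0.
Qed.

HB.instance Definition _ := GRing.Zmodule_isNzRing.Build krizE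
  krizE_mulA krizE_mul1x krizE_mulx1 krizE_mulDl krizE_mulDr krizE_one_neq0.

Lemma krizE_piM (u v : krizA) : krizE_pi (u * v) = krizE_pi u * krizE_pi v.
Proof. by rewrite -krizE_mul_pi. Qed.

Fact krizE_scaleAl (a : rat) (x y : krizE) : a *: (x * y) = a *: x * y.
Proof.
rewrite -(krizE_reprK x) -(krizE_reprK y) -krizE_piM -linearZ /=.
by rewrite scalerAl krizE_piM linearZ.
Qed.
HB.instance Definition _ := GRing.Lmodule_isLalgebra.Build rat krizE krizE_scaleAl.

Fact krizE_scaleAr (a : rat) (x y : krizE) : a *: (x * y) = x * (a *: y).
Proof.
rewrite -(krizE_reprK x) -(krizE_reprK y) -krizE_piM -linearZ /=.
by rewrite scalerAr krizE_piM linearZ.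
Qed.
HB.instance Definition _ := GRing.Lalgebra_isAlgebra.Build rat krizE krizE_scaleAr.
HB.instance Definition _ := Algebra_isFalgebra.Build rat krizE.

Definition kriz_d : 'End(krizE) := quot_end kriz_ideal kriz_dA.

Lemma kriz_d_pi (u : krizA) : kriz_d (krizE_pi u) = krizE_pi (kriz_dA u).
Proof. exact: (quot_endE kriz_dA_ideal). Qed.

Lemma kriz_d_sqr (x : krizE) : kriz_d (kriz_d x) = 0.
Proof. by rewrite -(krizE_reprK x) !kriz_d_pi kriz_dA_sqr linear0. Qed.

End Kriz.

Section Cohomology.
Variable n : nat.
Local Notation A := (krizA n).
Local Notation E := (krizE n).
Implicit Types (S : {set 'I_n + edge n}) (k q : nat).

Definition upper_degree S : nat := (2 * #|even_part S| + #|odd_part S|)%N.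

(* In [krizA_comp k q], [kriz_comp k q] = E_q^k, [kriz_coh k q] = H_q^k and so
   on, k is the upper (total) degree and q the lower one. *)
Definition krizA_comp k q : {vspace A} :=
  (\sum_(S | (upper_degree S == k) && (#|odd_part S| == q)) <[mon S : A]>)%VS.

Definition kriz_comp k q : {vspace E} := (krizE_pi n @: krizA_comp k q)%VS.

Definition kriz_cycles k q : {vspace E} := (kriz_comp k q :&: lker (kriz_d n))%VS.

Definition kriz_boundaries k q : {vspace E} :=
  if k is k'.+1 then (kriz_d n @: kriz_comp k' q.+1)%VS else 0%VS.

Definition kriz_coh k q : Type :=
  quotv (linfun (@vsval _ _ (kriz_cycles k q)) @^-1: kriz_boundaries k q)%VS.
HB.instance Definition _ k q := Vector.on (kriz_coh k q).

Definition betti k q : nat := \dim {: kriz_coh k q}.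

Lemma mem_krizA_comp S : mon S \in krizA_comp (upper_degree S) #|odd_part S|.
Proof. by rewrite memvE; apply: (sumv_sup S) => //; rewrite !eqxx. Qed.

Lemma krizA_compP (U : {vspace A}) k q :
  (forall S, upper_degree S = k -> #|odd_part S| = q -> mon S \in U) ->
  (krizA_comp k q <= U)%VS.
Proof. by move=> US; apply/subv_sumP => S /andP[/eqP Sk /eqP Sq]; rewrite -memvE US. Qed.

Lemma w_krizA_comp i k q (u : A) :
  u \in krizA_comp k q -> w i * u \in krizA_comp k.+2 q.
Proof.
have -> : (w i * u \in krizA_comp k.+2 q) = (u \in amull (w i) @^-1: krizA_comp k.+2 q)%VS.
  by rewrite -memv_preim lfunE.
apply: subvP; apply: krizA_compP => S <- <-; rewrite -memv_preim lfunE /= genM_mon.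
case: ifPn => iS; first exact: mem0v.
apply: memvZ; have := mem_krizA_comp (inl i |: S).
rewrite /upper_degree odd_part_evx (_ : even_part _ = i |: even_part S); last first.
  by apply/setP => j; rewrite !inE.
by rewrite cardsU1 inE iS mulnDr.
Qed.

Lemma krizA_comp_d k q (u : A) :
  u \in krizA_comp k q.+1 -> kriz_dA n u \in krizA_comp k.+1 q.
Proof.
rewrite memv_preim; apply: subvP; apply: krizA_compP => S Sk Sq.
rewrite -memv_preim /kriz_dA deriv_ofE; apply: memv_suml => e _.
rewrite contract_mon; case: ifPn => eS; last by rewrite mulr0 mem0v.
rewrite -scalerAr; apply: memvZ; have := mem_krizA_comp (S :\ inr e).
have oS : #|odd_part (S :\ inr e)| = q.
  have eo : e \in odd_part S by rewrite inE.
  move: Sq; rewrite (cardsD1 e) eo => -[<-]; congr #|pred_of_set _|.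
  by apply/setP => f; rewrite !inE (inj_eq inr_inj).
rewrite /upper_degree oS (_ : even_part _ = even_part S); last first.
  by apply/setP => i; rewrite !inE.
move: Sk; rewrite /upper_degree Sq => Sk mS; rewrite mulrDl -Sk addnS.
by apply: memvD; apply: w_krizA_comp.
Qed.

Lemma kriz_comp_d k q (x : E) :
  x \in kriz_comp k q.+1 -> kriz_d n x \in kriz_comp k.+1 q.
Proof.
move=> /memv_imgP[u uA ->]; rewrite kriz_d_pi; apply: memv_img.
exact: krizA_comp_d.
Qed.

Lemma kriz_boundaries_sub k q : (kriz_boundaries k q <= kriz_cycles k q)%VS.
Proof.
case: k => [|k]; first exact: sub0v.
apply/subvP => _ /memv_imgP[x xE ->].
by rewrite memv_cap kriz_comp_d // memv_ker kriz_d_sqr eqxx.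
Qed.

(* By [betti_eq0] the Poincare series has no term of degree >= degree_bound in
   t or in s, so it is the polynomial [poincare]; see [coef_poincare]. *)
Definition degree_bound : nat := (2 * n + n * n).+1.

Lemma kriz_comp_eq0 k q :
  (degree_bound <= k)%N || (degree_bound <= q)%N -> kriz_comp k q = 0%VS.
Proof.
move=> kq; apply/eqP; rewrite -subv0 -(limg0 (krizE_pi n)); apply: limgS.
apply: krizA_compP => S Sk Sq; suff : (k < degree_bound)%N && (q < degree_bound)%N.
  by case/andP=> kb qb; case/orP: kq; rewrite leqNgt ?kb ?qb.
have oS : (#|odd_part S| <= n * n)%N.
  apply: leq_trans (max_card _) _; rewrite card_sig.
  by apply: leq_trans (max_card _) _; rewrite card_prod card_ord.
have eS : (#|even_part S| <= n)%N.
  by apply: leq_trans (max_card _) _; rewrite card_ord.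
rewrite /degree_bound !ltnS -Sk -Sq leq_add ?leq_mul //=.
by apply: leq_trans oS _; apply: leq_addl.
Qed.

Lemma betti_eq0 k q :
  (degree_bound <= k)%N || (degree_bound <= q)%N -> betti k q = 0%N.
Proof.
move=> /kriz_comp_eq0 E0; apply/eqP; rewrite dimv_eq0; apply/eqP/vspaceP => x.
rewrite memvf memv0; apply/esym/eqP.
rewrite -[x]quot_reprK; set z := quot_repr _ _; suff -> : z = 0 by rewrite linear0.
apply: subvs_inj; have := subvsP z; rewrite memv_cap => /andP[].
by rewrite E0 memv0 linear0 => /eqP.
Qed.

Definition tvar : {poly {poly int}} := 'X%:P.
Definition svar : {poly {poly int}} := 'X.

Definition poincare : {poly {poly int}} :=
  \sum_(k < degree_bound) \sum_(q < degree_bound) (betti k q)%:R * tvar ^+ k * svar ^+ q.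

Lemma coef_poincare k q : poincare`_q`_k = (betti k q)%:R.
Proof.
have termE k' q' : ((betti k' q')%:R * tvar ^+ k' * svar ^+ q')`_q`_k
    = if (k == k') && (q == q') then (betti k' q')%:R else 0.
  rewrite -polyC_natr -polyC_exp -polyCM coefCM coefXn; case: eqP => _; last first.
    by rewrite mulr0 coef0 andbF.
  by rewrite mulr1 andbT -polyC_natr coefCM coefXn; case: eqP; rewrite (mulr1, mulr0).
rewrite /poincare !coef_sum; under eq_bigr do rewrite !coef_sum.
under eq_bigr do under eq_bigr do rewrite termE.
have [kq|] := boolP ((degree_bound <= k)%N || (degree_bound <= q)%N).
  rewrite betti_eq0 //; apply: big1 => i _; apply: big1 => j _.
  case: ifP => // /andP[/eqP ki /eqP qj]; move: kq.
  by rewrite ki qj leqNgt ltn_ord leqNgt ltn_ord.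
rewrite negb_or -!ltnNge => /andP[kb qb].
rewrite (big_only1 (Ordinal kb)) // => [|i ik _]; last first.
  by apply: big1 => j _; case: ifP => // /andP[/eqP ki _]; case/eqP: ik; apply: val_inj.
rewrite (big_only1 (Ordinal qb)) /= ?eqxx // => j jq _.
by case: ifP => // /eqP qj; case/eqP: jq; apply: val_inj.
Qed.
End Cohomology.

(* Main.v *)
(* E(n+1) is a free left E(n)-module with basis 1, w_{n+1}, G_{1,n+1}, ..., G_{n,n+1}:
   left multiplication by the generators of E(n+1) can be written down on the free module,
   and these operators satisfy the Kriz relations, so the free module is a retract of
   E(n+1). Since dG_{1,n+1} = w_1 + w_{n+1}, the basis elements w_1 + w_{n+1} and G_{1,n+1}
   span an acyclic summand. The remaining ones are 1 and G_{i,n+1} - G_{1,n+1}, with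
   differential w_i - w_1. If n >= 3, this is d(G_ij - G_1j) for a third index j, so after
   the correction by G_ij - G_1j they are closed and H(E(n+1)) is the sum of H(E(n)) and
   of n-1 copies of it shifted by st. If n = 2, then 1 and w_1 represent a basis of
   H(E(2)), the differential of the corrected basis element is -2 w_1, and the classes
   1 and w_1 (G_23 - G_13 - G_12) remain; they have degrees 1 and st^3. *)
From HB Require Import structures.
Require Import Defs.
From mathcomp Require Import all_boot all_order all_algebra falgebra ring zify.

Set Implicit Arguments.
Unset Strict Implicit.
Unset Printing Implicit Defensive.

Import GRing.Theory.
Local Open Scope ring_scope.

(** * Modules over the graded-commutative algebra and over the Kriz model *)

(** The obstacle is linear independence: a presentation by relations bounds E(n) only from above.
    The quotient is therefore used through one criterion: operators on a vector space that satisfy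
    the Kriz relations define an action of E(n). This serves twice: left multiplications on E(n+1)
    give the inclusion of E(n) as the orbit map of 1, and the operators on the free module give
    coordinates on E(n+1) as the orbit map of its first basis vector. The bigrading stays out of the
    homological algebra. [coh_basis] concerns the whole complex; since d and the chosen
    representatives are bihomogeneous, Betti numbers are obtained at the end by counting
    representatives. The isomorphisms of the theorem also come from counting: the induction carries
    an involution of the index set that exchanges the two kinds of classes. The case n = 2 is
    special because there w_2 - w_1 is cohomologous to -2 w_1, up to sign the Euler class of the
    sphere. It does not vanish in H(E(2)), and the cone of multiplication by it is rationally the
    cohomology of a 3-sphere. *)

Section GradedCommutativeAction.
Variables (I J : finType) (M : lmodType rat) (L : I + J -> M -> M).

Definition koszul (a b : I + J) : rat := if (a, b) is (inr _, inr _) then -1 else 1.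

Hypothesis L_linear : forall a, linear (L a).
Hypothesis L_comm : forall a b m, L a (L b m) = koszul a b *: L b (L a m).
Hypothesis L_sqr : forall a m, L a (L a m) = 0.

Let LD a m m' : L a (m + m') = L a m + L a m'.
Proof. by have := L_linear a 1 m m'; rewrite !scale1r. Qed.
Let L0 a : L a 0 = 0.
Proof. by have := LD a 0 0; rewrite addr0 -{1}[L a 0]addr0 => /addrI. Qed.
Let LZ a c m : L a (c *: m) = c *: L a m.
Proof. by have := L_linear a c m 0; rewrite L0 !addr0. Qed.

Definition sorted_gens : seq (I + J) := map inl (enum I) ++ map inr (enum J).

Definition mon_act (s : seq (I + J)) (S : {set I + J}) (m : M) : M :=
  foldr (fun b m => if b \in S then L b m else m) m s.

(** For a listed before b: pulling b across a costs the Koszul sign, pulling a across b costs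
    nothing. This is the order by [enum_rank] in which monomials are written. *)
Definition gen_before (a b : I + J) := (swap b a == koszul b a) && (swap a b == 1).

Lemma sorted_gens_pairwise : pairwise gen_before sorted_gens.
Proof.
rewrite pairwise_cat; apply/and3P; split.
- apply/allrelP => _ _ /mapP[i _ ->] /mapP[j _ ->].
  by rewrite /gen_before /koszul /= !eqxx.
- rewrite pairwise_map; elim: (enum I) => //= i s ->; rewrite andbT.
  by apply/allP => j _; rewrite /gen_before /koszul /= !eqxx.
rewrite pairwise_map; case eJ: (enum J) => [|x0 s] //; rewrite -eJ.
apply/(pairwiseP x0) => i j; rewrite !inE -cardE => iJ jJ ij /=.
have E k (kJ : (k < #|J|)%N) : nth x0 (enum J) k = enum_val (Ordinal kJ).
  by rewrite (enum_val_nth x0).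
rewrite /gen_before /koszul /= (E _ iJ) (E _ jJ) !enum_valK /= ij.
by rewrite ltnNge (ltnW ij) /= !eqxx.
Qed.

Lemma sorted_gens_mem a : a \in sorted_gens.
Proof.
by rewrite mem_cat; case: a => i; rewrite map_f ?mem_enum ?orbT.
Qed.

Lemma sorted_gens_uniq : uniq sorted_gens.
Proof.
have inlI : injective (@inl I J) by move=> i j [].
have inrI : injective (@inr I J) by move=> i j [].
rewrite /sorted_gens cat_uniq (map_inj_uniq inlI) (map_inj_uniq inrI) !enum_uniq.
rewrite andbT /=; apply/hasPn => _ /mapP[j _ ->].
by apply/mapP => -[i _].
Qed.

Lemma eq_mon_act s (S T : {set I + J}) m :
  {in s, S =i T} -> mon_act s S m = mon_act s T m.
Proof.
elim: s => //= b s IH bs; rewrite bs ?mem_head // IH // => a as_.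
by rewrite bs // inE as_ orbT.
Qed.

(** [L a] moves to its slot past the members of [S] listed before a, each giving its Koszul sign.
    Those listed after a have [swap a b = 1], so the product may run over all of [S]. *)
Lemma mon_actU1 s a (S : {set I + J}) m :
  pairwise gen_before s -> uniq s -> a \in s -> a \notin S ->
  mon_act s (a |: S) m = (\prod_(b <- s | b \in S) swap a b) *: L a (mon_act s S m).
Proof.
elim: s => //= b s IH /andP[bs ps] /andP[bNs us]; rewrite inE big_cons => as_ aS.
have [ab|ab] /= := eqVneq a b.
  rewrite -ab in bs bNs *; rewrite !inE eqxx (negPf aS) /= big_seq_cond big1 ?scale1r.
    congr (L a _); apply: eq_mon_act => c cs; rewrite !inE.
    by case: eqP cs bNs => // -> ->.
  by move=> c /andP[cs _]; have /andP[_ /eqP] := allP bs _ cs.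
rewrite (negPf ab) /= in as_; rewrite !inE eq_sym (negPf ab) /=.
case: ifP => bS; last exact: IH.
rewrite IH // LZ L_comm scalerA mulrC; congr (_ *: _).
have /andP[/eqP-> _] := allP bs _ as_; congr (_ * _).
by case: a b {IH as_ ab aS bs bNs bS} => [?|?] [].
Qed.

Lemma mon_act_gen s a (S : {set I + J}) m :
  pairwise gen_before s -> uniq s -> a \in s -> a \in S ->
  L a (mon_act s S m) = 0.
Proof.
move=> ps us as_ aS; rewrite -(setD1K aS) mon_actU1 ?setD11 //.
by rewrite LZ L_sqr scaler0.
Qed.

(* The module structure in which the generator a acts by [L a]. *)
Definition gc_act (u : gcalg I J) (m : M) : M :=
  \sum_S u S *: mon_act sorted_gens S m.

Lemma gc_act_mon S m : gc_act (mon S) m = mon_act sorted_gens S m.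
Proof.
rewrite /gc_act (big_only1 S) => // [|T /negPf TS _].
  by rewrite monE eqxx scale1r.
by rewrite monE TS scale0r.
Qed.

Lemma gc_actPl c u v m : gc_act (c *: u + v) m = c *: gc_act u m + gc_act v m.
Proof.
rewrite /gc_act scaler_sumr -big_split; apply: eq_bigr => S _ /=.
by rewrite !ffunE scalerDl scalerA.
Qed.

Lemma gc_actPr u c m m' : gc_act u (c *: m + m') = c *: gc_act u m + gc_act u m'.
Proof.
have lin s S : mon_act s S (c *: m + m') = c *: mon_act s S m + mon_act s S m'.
  by elim: s => //= b s ->; case: ifP => // _; rewrite LD LZ.
rewrite /gc_act scaler_sumr -big_split; apply: eq_bigr => S _ /=.
by rewrite lin scalerDr !scalerA mulrC.
Qed.

Lemma gc_act0l m : gc_act 0 m = 0.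
Proof. by rewrite /gc_act big1 // => S _; rewrite ffunE scale0r. Qed.

Lemma gc_actZl c u m : gc_act (c *: u) m = c *: gc_act u m.
Proof. by have := gc_actPl c u 0 m; rewrite gc_act0l !addr0. Qed.

Lemma gc_act1 m : gc_act 1 m = m.
Proof.
rewrite gc_act_mon; elim: sorted_gens => //= b s ->.
by rewrite inE.
Qed.

(** The signs of [genM_mon] and of [mon_actU1] are the same product of swaps and cancel. *)
Lemma gc_act_genM a u m : gc_act (gen a * u) m = L a (gc_act u m).
Proof.
elim/gcalg_ind: u => [c u v IHu IHv||S].
- rewrite mulrDr -scalerAr !gc_actPl IHu IHv.
  by rewrite LD LZ.
- by rewrite mulr0 gc_act0l L0.
rewrite genM_mon gc_act_mon; case: ifPn => aS.
  by rewrite gc_act0l mon_act_gen ?sorted_gens_pairwise ?sorted_gens_uniq ?sorted_gens_mem.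
rewrite gc_actZl gc_act_mon mon_actU1 ?sorted_gens_pairwise ?sorted_gens_uniq //;
  last exact: sorted_gens_mem.
rewrite scalerA (perm_big (index_enum (I + J)%type)) /=; last first.
  apply: uniq_perm; rewrite ?sorted_gens_uniq ?index_enum_uniq // => b.
  by rewrite sorted_gens_mem mem_index_enum.
by have := sgn_sqr [set a] S; rewrite /sgn big_set1 => ->; rewrite scale1r.
Qed.

Lemma gc_actM u v m : gc_act (u * v) m = gc_act u (gc_act v m).
Proof.
elim/gcalg_genind: u => [c u u' IH IH'|||i u IH|j u IH].
- by rewrite mulrDl -scalerAl !gc_actPl IH IH'.
- by rewrite mul0r !gc_act0l.
- by rewrite mul1r gc_act1.
- by rewrite -mulrA !gc_act_genM IH.
- by rewrite -mulrA !gc_act_genM IH.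
Qed.
End GradedCommutativeAction.

Section Parity.
Variables I J : finType.
Implicit Types u v : gcalg I J.

Lemma parityK u : parity I J (parity I J u) = u.
Proof.
elim/gcalg_genind: u => [a u v IHu IHv|||i u IH|j u IH].
- by rewrite !linearP /= IHu IHv.
- by rewrite !linear0.
- by rewrite !parity1.
- by rewrite !parity_evxM IH.
- by rewrite parity_odyM linearN /= parity_odyM opprK IH.
Qed.

Lemma ody_supercomm j u : ody j * u = parity I J u * ody j.
Proof.
elim/gcalg_genind: u => [a u v IHu IHv|||i u IH|k u IH].
- by rewrite linearP /= mulrDr mulrDl -scalerAr -scalerAl IHu IHv.
- by rewrite linear0 mulr0 mul0r.
- by rewrite parity1 mulr1 mul1r.
- by rewrite parity_evxM mulrA -evx_central -!mulrA IH.
- by rewrite parity_odyM mulrA odyC !mulNr -!mulrA IH.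
Qed.
End Parity.

(** * The Kriz relations for arbitrary indices *)

Section KrizAlgebra.
Variable n : nat.
Implicit Types (i j k : 'I_n) (x y : krizE n) (u v : krizA n).

Definition Ew i : krizE n := krizE_pi n (w i).
Definition Eg i j : krizE n := krizE_pi n (G i j).
Definition Epar : 'End(krizE n) := quot_end (kriz_ideal n) (parity _ _).

Lemma krizE_ind (P : krizE n -> Prop) : (forall u, P (krizE_pi n u)) -> forall x, P x.
Proof. by move=> Ppi x; rewrite -(krizE_reprK x). Qed.

Lemma krizE_pi1 : krizE_pi n 1 = 1.
Proof. by []. Qed.

Lemma parity_ideal : (parity 'I_n (edge n) @: kriz_ideal n <= kriz_ideal n)%VS.
Proof.
apply/subvP => _ /memv_imgP[u uI ->]; rewrite memv_preim.
apply: (subvP (kriz_idealP _)) uI => a r b rR; rewrite -memv_preim !parityM.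
apply: kriz_idealMr; apply: kriz_idealMl; apply: (subvP (@kriz_rel_sub n)).
exact: parity_kriz_rel.
Qed.

Lemma Epar_pi u : Epar (krizE_pi n u) = krizE_pi n (parity _ _ u).
Proof. exact: (quot_endE parity_ideal). Qed.

Lemma EparM x y : Epar (x * y) = Epar x * Epar y.
Proof.
elim/krizE_ind: x => u; elim/krizE_ind: y => v.
by rewrite -krizE_piM !Epar_pi -krizE_piM parityM.
Qed.

Lemma EparK x : Epar (Epar x) = x.
Proof. by elim/krizE_ind: x => u; rewrite !Epar_pi parityK. Qed.

Lemma Epar1 : Epar 1 = 1.
Proof. by rewrite -krizE_pi1 Epar_pi parity1. Qed.

Lemma Epar_w i : Epar (Ew i) = Ew i.
Proof. by rewrite Epar_pi parity_w. Qed.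

Lemma Epar_g i j : Epar (Eg i j) = - Eg i j.
Proof. by rewrite Epar_pi parityG linearN. Qed.

Lemma EwC i x : Ew i * x = x * Ew i.
Proof. by elim/krizE_ind: x => u; rewrite -!krizE_piM wC. Qed.

Lemma Ew_sqr i : Ew i * Ew i = 0.
Proof. by rewrite -krizE_piM w_sqr linear0. Qed.

Lemma Eg_supercomm i j x : Eg i j * x = Epar x * Eg i j.
Proof.
elim/krizE_ind: x => u; rewrite Epar_pi -!krizE_piM; congr (krizE_pi n _).
by rewrite /G; case: insub => [e|]; rewrite ?ody_supercomm // mulr0 mul0r.
Qed.

(** Thanks to the dummy value 0 on the diagonal, the relations below hold for all indices, and sums
    over a free index need no side condition. *)
Lemma Eg_diag i : Eg i i = 0.
Proof. by rewrite /Eg /G insubF ?linear0 //= eqxx. Qed.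

Lemma Eg_sym i j : Eg i j = Eg j i.
Proof.
have [->|ij] := eqVneq i j => //; apply/esym/krizE_piP.
by apply: (subvP (@kriz_rel_sub n)); apply: kriz_rel1.
Qed.

Lemma EgC i j k l : Eg i j * Eg k l = - (Eg k l * Eg i j).
Proof. by rewrite Eg_supercomm Epar_g mulNr. Qed.

Lemma Eg_sqr i j : Eg i j * Eg i j = 0.
Proof.
rewrite -krizE_piM /G; case: insub => [e|]; first by rewrite ody_sqr linear0.
by rewrite mul0r linear0.
Qed.

Lemma Ewg i j : Ew i * Eg i j = Ew j * Eg i j.
Proof.
have wg (k l : 'I_n) : (k < l)%N -> Ew k * Eg k l = Ew l * Eg k l.
  move=> kl; rewrite -!krizE_piM; apply/esym/krizE_piP.
  by apply: (subvP (@kriz_rel_sub n)); apply: kriz_rel2.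
case: (ltngtP i j) => [ij|ji|/ord_inj->] //; first exact: wg.
by rewrite Eg_sym wg.
Qed.

(** The relation is stable under the transpositions [P12] and [P23], hence under all permutations of
    the indices, so the defining case i < j < k suffices. If two indices coincide, both sides
    vanish. *)
Lemma Earnold i j k : Eg i k * Eg j k = Eg i j * Eg j k - Eg i j * Eg i k.
Proof.
pose P i j k := Eg i k * Eg j k = Eg i j * Eg j k - Eg i j * Eg i k.
have P12 a b c : P a b c -> P b a c.
  by rewrite /P => abc; rewrite EgC abc opprB (Eg_sym b a).
have P23 a b c : P a b c -> P a c b.
  by rewrite /P => abc; rewrite (Eg_sym c b) abc (EgC a c a b) opprK subrK.
have Plt (a b c : 'I_n) : (a < b)%N -> (b < c)%N -> P a b c.
  move=> ab bc; rewrite /P -!krizE_piM -linearB /=; apply/krizE_piP.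
  by apply: (subvP (@kriz_rel_sub n)); apply: kriz_rel3.
rewrite -/(P i j k).
case: (ltngtP i j) => [ij|ji|/ord_inj->]; last first.
- by rewrite /P Eg_diag !mul0r subrr Eg_sqr.
- case: (ltngtP i k) => [ik|ki|/ord_inj->].
  + by apply: (P12); apply: Plt.
  + case: (ltngtP j k) => [jk|kj|/ord_inj->].
    * by apply: (P12); apply: (P23); apply: Plt.
    * by apply: (P23); apply: (P12); apply: (P23); apply: Plt.
    * by rewrite /P Eg_diag !mulr0 Eg_sqr subrr.
  + by rewrite /P Eg_diag mul0r mulr0 subr0 (Eg_sym j) Eg_sqr.
- case: (ltngtP j k) => [jk|kj|/ord_inj->].
  + exact: Plt.
  + case: (ltngtP i k) => [ik|ki|/ord_inj->].
    * by apply: (P23); apply: Plt.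
    * by apply: (P23); apply: (P12); apply: Plt.
    * by rewrite /P Eg_diag mul0r mulr0 subr0 (Eg_sym j) Eg_sqr.
  + by rewrite /P Eg_diag !mulr0 Eg_sqr subrr.
Qed.

Lemma Ed_leibniz x y : kriz_d n (x * y) = kriz_d n x * y + Epar x * kriz_d n y.
Proof.
elim/krizE_ind: x => u; elim/krizE_ind: y => v.
by rewrite -krizE_piM !kriz_d_pi Epar_pi -!krizE_piM kriz_dA_leibniz linearD.
Qed.

Lemma Ed_w i : kriz_d n (Ew i) = 0.
Proof. by rewrite kriz_d_pi kriz_dA_w linear0. Qed.

Lemma Ed_g i j : i != j -> kriz_d n (Eg i j) = Ew i + Ew j.
Proof. by move=> ij; rewrite kriz_d_pi kriz_dA_G // linearD. Qed.

Lemma Ed1 : kriz_d n 1 = 0.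
Proof.
by have := Ed_leibniz 1 1; rewrite !mulr1 Epar1 mul1r -{1}[kriz_d n 1]addr0 => /addrI.
Qed.

Lemma krizE_genind (P : krizE n -> Prop) :
  (forall a x y, P x -> P y -> P (a *: x + y)) -> P 0 -> P 1 ->
  (forall i x, P x -> P (Ew i * x)) ->
  (forall i j x, i != j -> P x -> P (Eg i j * x)) -> forall x, P x.
Proof.
move=> PD P0 P1 Pw Pg; apply: krizE_ind.
elim/gcalg_genind => [a u v IHu IHv|||i u IH|e u IH].
- by rewrite linearP; apply: PD.
- by rewrite linear0.
- exact: P1.
- by rewrite krizE_piM; apply: Pw.
have -> : ody e = G (val e).1 (val e).2.
  rewrite /G -surjective_pairing; case: insubP => [f _ /val_inj-> //|].
  by rewrite (valP e).
by rewrite krizE_piM; apply: Pg => //; apply: (valP e).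
Qed.

Lemma Ed_par x : kriz_d n (Epar x) = - Epar (kriz_d n x).
Proof.
elim/krizE_genind: x => [a x y IHx IHy|||i x IH|i j x ij IH].
- by rewrite !linearP /= IHx IHy scalerN -opprD -linearP.
- by rewrite !linear0.
- by rewrite Epar1 Ed1 !linear0.
- by rewrite EparM Epar_w !Ed_leibniz Ed_w !mul0r !add0r !EparM !Epar_w IH mulrN.
rewrite EparM Epar_g mulNr linearN /= !Ed_leibniz Ed_g //; congr (- _).
by rewrite [in RHS]linearD /= !EparM EparK linearD /= !Epar_w Epar_g IH mulrNN.
Qed.
End KrizAlgebra.

(** * Actions of the Kriz model given by operators *)

Definition gen_act n (M : Type) (Lw : 'I_n -> M -> M) (Lg : 'I_n -> 'I_n -> M -> M)
    (a : 'I_n + edge n) : M -> M :=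
  match a with inl i => Lw i | inr e => Lg (val e).1 (val e).2 end.

(* Locked: otherwise unification unfolds it into sums over monomials. *)
HB.lock Definition kriz_act n (M : lmodType rat) (Lw : 'I_n -> M -> M)
    (Lg : 'I_n -> 'I_n -> M -> M) (x : krizE n) (p : M) : M :=
  gc_act (gen_act Lw Lg) (krizE_repr n x) p.

Section KrizAction.
Variables (n : nat) (M : vectType rat).
Variables (Lw : 'I_n -> M -> M) (Lg : 'I_n -> 'I_n -> M -> M).

Record kriz_action : Prop := KrizAction {
  Lw_linear : forall i, linear (Lw i);
  Lg_linear : forall i j, i != j -> linear (Lg i j);
  Lw_comm : forall i j p, Lw i (Lw j p) = Lw j (Lw i p);
  Lw_sqr : forall i p, Lw i (Lw i p) = 0;
  Lwg_comm : forall i j k p, j != k -> Lg j k (Lw i p) = Lw i (Lg j k p);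
  Lg_comm : forall i j k l p, i != j -> k != l ->
    Lg i j (Lg k l p) = - Lg k l (Lg i j p);
  Lg_sym : forall i j p, i != j -> Lg i j p = Lg j i p;
  Lwg : forall (i j : 'I_n) p, (i < j)%N -> Lw j (Lg i j p) = Lw i (Lg i j p);
  Lg_arnold : forall (i j k : 'I_n) p, (i < j)%N -> (j < k)%N ->
    Lg i k (Lg j k p) = Lg i j (Lg j k p) - Lg i j (Lg i k p) }.

Local Notation gen_act := (gen_act Lw Lg).
Local Notation kriz_act := (kriz_act Lw Lg).
Hypothesis L : kriz_action.

Lemma gen_act_linear a : linear (gen_act a).
Proof.
case: a => [i|e] /=; first exact: (Lw_linear L).
by apply: (Lg_linear L); apply: (valP e).
Qed.

Lemma gen_act_comm a b p : gen_act a (gen_act b p) = koszul a b *: gen_act b (gen_act a p).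
Proof.
case: a b => [i|e] [j|f] /=; rewrite ?scale1r ?scaleN1r; first exact: (Lw_comm L).
- by rewrite (Lwg_comm L) //; apply: (valP f).
- by rewrite (Lwg_comm L) //; apply: (valP e).
- by rewrite (Lg_comm L) //; [apply: (valP e)|apply: (valP f)].
Qed.

Lemma opp_self_eq0 (p : M) : p = - p -> p = 0.
Proof.
move=> /eqP; rewrite -addr_eq0 -mulr2n -scaler_nat scaler_eq0.
by rewrite (_ : 2%:R == 0 :> rat = false) // => /eqP.
Qed.

(** For an edge, anticommutation of the operator with itself makes the square its own negative, and
    2 is invertible. *)
Lemma gen_act_sqr a p : gen_act a (gen_act a p) = 0.
Proof.
case: a => [i|e] /=; first exact: (Lw_sqr L).
by apply: opp_self_eq0; apply: (Lg_comm L); apply: (valP e).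
Qed.

Let actM (u v : krizA n) p :
  gc_act gen_act (u * v) p = gc_act gen_act u (gc_act gen_act v p).
Proof. exact: (gc_actM gen_act_linear gen_act_comm gen_act_sqr). Qed.
Let act_genM := gc_act_genM gen_act_linear gen_act_comm gen_act_sqr.
Let act1 := gc_act1 gen_act.
Let actPr := gc_actPr gen_act_linear.
Let actB (u v : krizA n) p :
  gc_act gen_act (u - v) p = gc_act gen_act u p - gc_act gen_act v p.
Proof. by have := gc_actPl gen_act (-1) v u p; rewrite !scaleN1r addrC [in RHS]addrC. Qed.

Lemma gc_act_w i p : gc_act gen_act (w i) p = Lw i p.
Proof. by rewrite -[w i]mulr1 act_genM act1. Qed.

Lemma gc_act_G i j p : i != j -> gc_act gen_act (G i j) p = Lg i j p.
Proof.
move=> ij; rewrite /G; case: insubP => [e _ eE|]; last by rewrite /= ij.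
by rewrite -[ody e]mulr1 act_genM act1 /= eE.
Qed.

(** An annihilator is a subspace, so only products a r b with a relation r are tested. As b moves p,
    each relation has to kill an arbitrary vector q. *)
Lemma gc_act_ideal u p : u \in kriz_ideal n -> gc_act gen_act u p = 0.
Proof.
have neq (i j : 'I_n) : (i < j)%N -> i != j by move=> ij; rewrite neq_ltn ij.
have lin q : linear (gc_act gen_act ^~ q) by move=> c v v'; apply: gc_actPl.
pose K q : {vspace krizA n} := lker (linfun (HB.pack_for {linear krizA n -> M}
  (gc_act gen_act ^~ q) (GRing.isLinear.Build _ _ _ _ _ (lin q)))).
have KP q v : (v \in K q) = (gc_act gen_act v q == 0) by rewrite memv_ker lfunE.
move=> uI; apply/eqP; rewrite -KP; apply: (subvP (kriz_idealP _)) uI => a r b rR.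
rewrite KP !actM; suff -> : gc_act gen_act r (gc_act gen_act b p) = 0.
  by have := actPr a (-1) 0 0; rewrite scaler0 addr0 scaleN1r addNr => ->.
move: (gc_act gen_act b p) => q; apply/eqP; rewrite -KP.
apply: subvP rR; apply: kriz_relP => [i j ij|i j ij|i j k ij jk];
  rewrite KP actB subr_eq0; apply/eqP.
- by rewrite !gc_act_G // 1?eq_sym // -(Lg_sym L).
- by rewrite !actM !gc_act_w !gc_act_G ?neq // (Lwg L).
have ik := ltn_trans ij jk.
by rewrite !actB !actM !gc_act_G ?neq // (Lg_arnold L).
Qed.

(** The action does not depend on the representative chosen by [krizE_repr]; multiplicativity on
    E(n) rests on this. *)
Lemma kriz_act_pi u p : kriz_act (krizE_pi n u) p = gc_act gen_act u p.
Proof.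
rewrite unlock; apply/eqP; rewrite -subr_eq0 -actB gc_act_ideal //.
by apply/krizE_piP; rewrite krizE_reprK.
Qed.

Lemma kriz_act1 p : kriz_act 1 p = p.
Proof. by rewrite -krizE_pi1 kriz_act_pi act1. Qed.

Lemma kriz_actM x y p : kriz_act (x * y) p = kriz_act x (kriz_act y p).
Proof.
elim/krizE_ind: x => u; elim/krizE_ind: y => v.
by rewrite -krizE_piM !kriz_act_pi actM.
Qed.

Lemma kriz_actPl c x y p : kriz_act (c *: x + y) p = c *: kriz_act x p + kriz_act y p.
Proof. by rewrite unlock linearP gc_actPl. Qed.

Lemma kriz_act0l p : kriz_act 0 p = 0.
Proof. by rewrite unlock linear0 gc_act0l. Qed.

Lemma kriz_act_w i p : kriz_act (Ew i) p = Lw i p.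
Proof. by rewrite kriz_act_pi gc_act_w. Qed.

Lemma kriz_act_g i j p : i != j -> kriz_act (Eg i j) p = Lg i j p.
Proof. by move=> ij; rewrite kriz_act_pi gc_act_G. Qed.
End KrizAction.

(** * Freeness of E(n+1) over E(n) *)

Section AdjoinPoint.
Variables (n : nat) (B : falgType rat).
Variables (w : 'I_n -> B) (g : 'I_n -> 'I_n -> B) (par : B -> B).
Hypothesis par_linear : linear par.
Hypothesis parM : forall x y, par (x * y) = par x * par y.
Hypothesis parK : involutive par.
Hypothesis par_w : forall i, par (w i) = w i.
Hypothesis par_g : forall i j, par (g i j) = - g i j.
Hypothesis w_central : forall i x, w i * x = x * w i.
Hypothesis w_sqr : forall i, w i * w i = 0.
Hypothesis g_supercomm : forall i j x, g i j * x = par x * g i j.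
Hypothesis g_sym : forall i j, g i j = g j i.
Hypothesis wg : forall i j, w i * g i j = w j * g i j.
Hypothesis arnold : forall i j k, g i k * g j k = g i j * g j k - g i j * g i k.

(* (x, y, m) stands for x + y w_new + sum_i m_i G_(i,new); [adj_mul], [adj_w] and [adj_g i]
   are the left multiplications by b, w_new and G_(i,new). *)
Local Notation adj := (B * B * {ffun 'I_n -> B})%type.

Let parD x y : par (x + y) = par x + par y.
Proof. by have := par_linear 1 x y; rewrite !scale1r. Qed.
Let par0 : par 0 = 0.
Proof. by have := parD 0 0; rewrite addr0 -{1}[par 0]addr0 => /addrI. Qed.
Let parZ c x : par (c *: x) = c *: par x.
Proof. by have := par_linear c x 0; rewrite par0 !addr0. Qed.
Let parN x : par (- x) = - par x.
Proof. by rewrite -scaleN1r parZ scaleN1r. Qed.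
Let parS (F : 'I_n -> B) : par (\sum_t F t) = \sum_t par (F t).
Proof. exact: (big_morph par parD par0). Qed.
Let gC i j k l : g i j * g k l = - (g k l * g i j).
Proof. by rewrite g_supercomm par_g mulNr. Qed.

Definition adj_mul (b : B) (p : adj) : adj :=
  (b * p.1.1, b * p.1.2, [ffun i => b * p.2 i]).

Definition adj_w (p : adj) : adj := (0, p.1.1, [ffun i => w i * p.2 i]).

(** Moving G_(i,new) across a coefficient applies [par]; G_(i,new) w_new = w_i G_(i,new); and the
    Arnold relation turns G_(i,new) G_(t,new) into g_it (G_(t,new) - G_(i,new)). The first terms of
    these differences are the sum part of [adj_g]; all the rest is a multiple of G_(i,new),
    collected here. *)
Definition adj_coef i (p : adj) : B :=
  par p.1.1 + par p.1.2 * w i - \sum_t par (p.2 t) * g i t.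

Definition adj_g i (p : adj) : adj :=
  (0, 0, [ffun j => par (p.2 j) * g i j + (j == i)%:R *: adj_coef i p]).

Lemma adjP (p q : adj) :
  p.1.1 = q.1.1 -> p.1.2 = q.1.2 -> p.2 =1 q.2 -> p = q.
Proof. by move: p q => [[x y] m] [[x' y'] m'] /= -> -> /ffunP->. Qed.

Lemma adj_mul_linear b : linear (adj_mul b).
Proof.
by move=> c p q; apply: adjP => [||j]; rewrite /= ?ffunE /= ?ffunE ?mulrDr -?scalerAr //.
Qed.

Lemma adj_mulPl c b b' p : adj_mul (c *: b + b') p = c *: adj_mul b p + adj_mul b' p.
Proof.
by apply: adjP => [||j]; rewrite /= ?ffunE /= ?ffunE ?mulrDl -?scalerAl.
Qed.

Lemma adj_mul0 p : adj_mul 0 p = 0.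
Proof. by apply: adjP => [||j]; rewrite /= ?ffunE mul0r. Qed.

Lemma adj_mulN b p : adj_mul (- b) p = - adj_mul b p.
Proof. by have := adj_mulPl (-1) b 0 p; rewrite !scaleN1r adj_mul0 !addr0. Qed.

Lemma adj_mulBl b b' p : adj_mul (b - b') p = adj_mul b p - adj_mul b' p.
Proof. by rewrite addrC -scaleN1r adj_mulPl scaleN1r addrC. Qed.

Lemma adj_mulBr b p q : adj_mul b (p - q) = adj_mul b p - adj_mul b q.
Proof. by rewrite addrC -scaleN1r adj_mul_linear scaleN1r addrC. Qed.

Lemma adj_mulA b b' p : adj_mul (b * b') p = adj_mul b (adj_mul b' p).
Proof. by apply: adjP => [||j]; rewrite /= ?ffunE -mulrA. Qed.

Lemma adj_mul1 p : adj_mul 1 p = p.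
Proof. by apply: adjP => [||j]; rewrite /= ?ffunE mul1r. Qed.

Lemma adj_w_linear : linear adj_w.
Proof.
move=> c p q; apply: adjP => [||j] //=; first by rewrite scaler0 addr0.
by rewrite !ffunE mulrDr -scalerAr.
Qed.

Lemma adj_w_mul b p : adj_w (adj_mul b p) = adj_mul b (adj_w p).
Proof.
apply: adjP => [||j] //=; rewrite ?mulr0 //.
by rewrite !ffunE !mulrA w_central.
Qed.

Lemma adj_w_sqr p : adj_w (adj_w p) = 0.
Proof. by apply: adjP => [||j] //=; rewrite !ffunE mulrA w_sqr mul0r. Qed.

Lemma adj_coef_linear i : linear (adj_coef i).
Proof.
move=> c p q; rewrite /adj_coef /= !par_linear mulrDl -scalerAl.
under eq_bigr => t _ do rewrite !ffunE par_linear mulrDl -scalerAl.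
rewrite big_split -scaler_sumr /= opprD !scalerDr scalerN.
by rewrite [X in X + _ = _]addrACA [LHS]addrACA.
Qed.

Lemma adj_gE i p j :
  (adj_g i p).2 j = par (p.2 j) * g i j + (j == i)%:R *: adj_coef i p.
Proof. by rewrite ffunE. Qed.

Lemma adj_g_linear i : linear (adj_g i).
Proof.
move=> c p q; apply: adjP => [||j] /=; rewrite ?scaler0 ?addr0 //.
rewrite !ffunE adj_coef_linear par_linear mulrDl -scalerAl !scalerDr.
by rewrite addrACA !scalerA mulrC.
Qed.

Lemma adj_coef_mul i b p : adj_coef i (adj_mul b p) = par b * adj_coef i p.
Proof.
rewrite /adj_coef /= !parM !mulrBr mulrDr mulrA mulr_sumr; congr (_ - _).
by apply: eq_bigr => t _; rewrite !ffunE parM mulrA.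
Qed.

Lemma adj_g_mul i b p : adj_g i (adj_mul b p) = adj_mul (par b) (adj_g i p).
Proof.
apply: adjP => [||j] /=; rewrite ?mulr0 //.
by rewrite !ffunE /= adj_coef_mul parM [in RHS]mulrDr mulrA scalerAr.
Qed.

Lemma adj_coef_w i p : adj_coef i (adj_w p) = w i * adj_coef i p.
Proof.
rewrite /adj_coef /= par0 add0r mulrBr mulrDr mulr_sumr -w_central.
rewrite -w_central mulrA w_sqr mul0r addr0; congr (_ - _).
apply: eq_bigr => t _; rewrite !ffunE parM par_w mulrA.
by rewrite w_central -mulrA -wg !mulrA w_central.
Qed.

Lemma adj_g_w i p : adj_g i (adj_w p) = adj_w (adj_g i p).
Proof.
apply: adjP => [||j] //=; rewrite !ffunE adj_coef_w parM par_w [in RHS]mulrDr mulrA.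
congr (_ + _); rewrite -scalerAr; case: eqP => [->|] //.
by rewrite !scale0r.
Qed.

Lemma adj_w_g i p : adj_w (adj_g i p) = adj_mul (w i) (adj_g i p).
Proof.
apply: adjP => [||j] /=; rewrite ?mulr0 //.
rewrite !ffunE !mulrDr -!scalerAr; congr (_ + _); last first.
  by case: eqP => [->|]; rewrite ?scale0r.
by rewrite w_central -mulrA -w_central -wg !mulrA w_central.
Qed.

Lemma par_adj_coef i p :
  par (adj_coef i p) = p.1.1 + p.1.2 * w i + \sum_t p.2 t * g i t.
Proof.
rewrite /adj_coef !parD parN parM !parK par_w parS -sumrN; congr (_ + _).
by apply: eq_bigr => t _; rewrite parM parK par_g mulrN opprK.
Qed.

Lemma adj_coef_g i k p :
  adj_coef i (adj_g k p) =
  \sum_t p.2 t * g k t * g i t - par (adj_coef k p) * g i k.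
Proof.
rewrite {1}/adj_coef par0 mul0r addr0 add0r -sumrN.
under eq_bigr => t _ do
  rewrite adj_gE parD parM parK par_g parZ mulrDl mulrN mulNr opprD opprK.
rewrite big_split /=; congr (_ + _); rewrite (big_only1 k) // => [|t /negPf tk _].
  by rewrite eqxx scale1r.
by rewrite tk scale0r mul0r oppr0.
Qed.

(** The terms in [p.1.1] cancel, those in [p.1.2] cancel by [wg], and what remains is the Arnold
    relation for i, k, t multiplied by [p.2 t] and summed over t. This settles the exceptional
    coordinates in the quadratic relations between the [adj_g]. *)
Lemma adj_coef_exch i k p :
  par (adj_coef k p) * g i k - par (adj_coef i p) * g i k
  + \sum_t p.2 t * g i t * g k t = 0.
Proof.
have S0 : (\sum_t p.2 t * g k t) * g i k - (\sum_t p.2 t * g i t) * g i k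
    + \sum_t p.2 t * g i t * g k t = 0.
  rewrite !mulr_suml -sumrB -big_split big1 // => t _ /=.
  rewrite -!mulrA -mulrBr -mulrDr arnold (gC k t) (gC i t) opprK.
  by rewrite addrACA addNr subrr addr0 mulr0.
apply: etrans S0; rewrite !par_adj_coef; congr (_ + _).
have wE : p.1.2 * w k * g i k = p.1.2 * w i * g i k by rewrite -!mulrA wg.
by rewrite !mulrDl wE opprD addrACA subrr add0r.
Qed.

Lemma adj_g_gE i k p l : (adj_g i (adj_g k p)).2 l =
  - (p.2 l * (g k l * g i l)) + (l == k)%:R *: (par (adj_coef k p) * g i l)
  + (l == i)%:R *: (\sum_t p.2 t * g k t * g i t - par (adj_coef k p) * g i k).
Proof.
rewrite adj_gE adj_coef_g adj_gE; congr (_ + _); move: (adj_coef k p) => c.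
by rewrite parD parM parK par_g parZ mulrDl mulrN mulNr mulrA scalerAl.
Qed.

Lemma adj_g_comm i k p : adj_g i (adj_g k p) = - adj_g k (adj_g i p).
Proof.
apply: adjP => [||l] /=; rewrite ?oppr0 // [RHS]ffunE !adj_g_gE.
(* The generic term is antisymmetric by [gC]; the extra terms at the coordinates k and i need the
   exchange identity, once in each order. *)
have := (adj_coef_exch i k p, adj_coef_exch k i p).
move: (par (adj_coef i p)) (par (adj_coef k p)) => c d [ik ki].
rewrite (gC k l i l) mulrN opprK !opprD opprK -!addrA; congr (_ + _).
rewrite [RHS]addrC -!scalerN; congr (_ + _).
  case: eqP => [->|]; rewrite ?scale0r // !scale1r.
  move/eqP: ik; rewrite addr_eq0 subr_eq => /eqP->.
  by rewrite (g_sym k i) opprB addrC.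
case: eqP => [->|]; rewrite ?scale0r // !scale1r.
move/eqP: ki; rewrite -addrA addr_eq0 => /eqP->.
by rewrite (g_sym i k) opprK addrC.
Qed.

(** The generic term is the Arnold relation in [B], the extra term at j agrees directly, and the one
    at i is the exchange identity. *)
Lemma adj_g_arnold i j p :
  adj_g i (adj_g j p) = adj_mul (g i j) (adj_g j p - adj_g i p).
Proof.
apply: adjP => [||l]; rewrite /= ?subrr ?mulr0 //; rewrite adj_g_gE.
rewrite !ffunE.
have := adj_coef_exch i j p.
have gpar x y z : g x y * par z = z * g x y by rewrite g_supercomm parK.
rewrite -{2}(parK (adj_coef i p)) -{4}(parK (adj_coef j p)).
move: (par (adj_coef i p)) (par (adj_coef j p)) => c d ij.
have -> : forall m b b' : B,
    g i j * (par m * g j l + (l == j)%:R *: b - (par m * g i l + (l == i)%:R *: b'))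
    = m * (g i j * g j l - g i j * g i l)
      + ((l == j)%:R *: (g i j * b) - (l == i)%:R *: (g i j * b')).
  move=> m b b'; rewrite opprD addrACA mulrDr mulrBr !mulrA !gpar -!mulrA -mulrBr.
  by congr (_ + _); rewrite mulrBr !scalerAr.
rewrite !gpar -arnold (gC j l i l) mulrN opprK -addrA -scalerN; congr (_ + (_ + _)).
  by case: eqP => [->|]; rewrite ?scale0r.
case: eqP => _; rewrite ?scale0r // !scale1r.
have -> : \sum_t p.2 t * g j t * g i t = - \sum_t p.2 t * g i t * g j t.
  by rewrite -sumrN; apply: eq_bigr => t _; rewrite -!mulrA (gC j t) mulrN.
move/eqP: ij; rewrite addr_eq0 => /eqP<-.
by rewrite addrAC subrr add0r.
Qed.

Definition adjoin_w (i : 'I_n.+1) : adj -> adj :=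
  if unlift ord_max i is Some j then adj_mul (w j) else adj_w.

(* [adjoin_g ord_max ord_max] is a dummy. *)
Definition adjoin_g (i j : 'I_n.+1) : adj -> adj :=
  match unlift ord_max i, unlift ord_max j with
  | Some k, Some l => adj_mul (g k l)
  | Some k, None | None, Some k => adj_g k
  | None, None => fun=> 0
  end.

Lemma adj_kriz_action : kriz_action adjoin_w adjoin_g.
Proof.
have new_neq : (@ord_max n != ord_max) = false by rewrite eqxx.
split; rewrite /adjoin_w /adjoin_g.
- by move=> i; case: unliftP => [j _|_]; [apply: adj_mul_linear|apply: adj_w_linear].
- move=> i j ij; case: unliftP ij => [k ->|->]; case: unliftP => [l ->|->] ij.
  + exact: adj_mul_linear.
  + exact: adj_g_linear.
  + exact: adj_g_linear.
  + by rewrite eqxx in ij.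
- move=> i j p; case: unliftP => [k _|_]; case: unliftP => [l _|_].
  + by rewrite -!adj_mulA w_central.
  + by rewrite adj_w_mul.
  + by rewrite adj_w_mul.
  + by [].
- move=> i p; case: unliftP => [k _|_]; last exact: adj_w_sqr.
  by rewrite -adj_mulA w_sqr adj_mul0.
- move=> i j k p jk; case: (unliftP _ i) => [a _|_]; case: (unliftP _ j) jk => [b ->|->];
    case: (unliftP _ k) => [c ->|->] jk; rewrite ?new_neq // in jk *.
  + by rewrite -!adj_mulA w_central.
  + by rewrite adj_g_mul par_w.
  + by rewrite adj_g_mul par_w.
  + by rewrite adj_w_mul.
  + by rewrite adj_g_w.
  + by rewrite adj_g_w.
- move=> i j k l p ij kl.
  case: (unliftP _ i) ij => [a ->|->]; case: (unliftP _ j) => [b ->|->] ij;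
  case: (unliftP _ k) kl => [c ->|->]; case: (unliftP _ l) => [d ->|->] kl;
    rewrite ?new_neq // in ij kl *;
    rewrite ?adj_g_mul ?par_g ?adj_mulN ?opprK //; try exact: adj_g_comm.
  by rewrite -!adj_mulA gC adj_mulN.
- move=> i j p ij.
  case: (unliftP _ i) ij => [a ->|->]; case: (unliftP _ j) => [b ->|->] // _.
  by rewrite g_sym.
- move=> i j p ij.
  case: (unliftP _ i) ij => [a ->|->]; case: (unliftP _ j) => [b ->|->] ij.
  + by rewrite -!adj_mulA wg.
  + by rewrite adj_w_g.
  + by rewrite adj_w_g.
  + by [].
move=> i j k p ij jk.
(* The new index is the largest, so in i < j < k only k can be new. *)
have lt_new (a b : 'I_n.+1) : (a < b)%N -> a != ord_max.
  by move=> ab; rewrite neq_ltn (leq_trans ab) // leq_ord.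
case: (unliftP _ i) (lt_new _ _ ij) => [a _ _|->]; last by rewrite eqxx.
case: (unliftP _ j) (lt_new _ _ jk) => [b _ _|->]; last by rewrite eqxx.
case: unliftP => [c _|_]; last by rewrite adj_g_arnold adj_mulBr.
by rewrite -!adj_mulA arnold adj_mulBl.
Qed.

Variables (B' : algType rat) (inc : {linear B -> B'}) (W : B') (Gam : 'I_n -> B').
Hypothesis incM : forall x y, inc (x * y) = inc x * inc y.
Hypothesis W_central : forall x, W * x = x * W.
Hypothesis W_sqr : W * W = 0.
Hypothesis WGam : forall i, W * Gam i = inc (w i) * Gam i.
Hypothesis Gam_supercomm : forall i x, Gam i * inc x = inc (par x) * Gam i.
Hypothesis Gam_arnold : forall i t,
  Gam i * Gam t = inc (g i t) * Gam t - inc (g i t) * Gam i.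

Definition assemble (p : adj) : B' :=
  inc p.1.1 + inc p.1.2 * W + \sum_i inc (p.2 i) * Gam i.

Lemma assemble_linear : linear assemble.
Proof.
move=> c p q; rewrite /assemble /= !linearP /= mulrDl -scalerAl !scalerDr.
under eq_bigr => i _ do rewrite !ffunE linearP /= mulrDl -scalerAl.
by rewrite big_split -scaler_sumr /= [X in X + _ = _]addrACA [LHS]addrACA.
Qed.

Lemma assemble_mul b p : assemble (adj_mul b p) = inc b * assemble p.
Proof.
rewrite /assemble /= !incM -mulrA !mulrDr mulr_sumr; congr (_ + _).
by apply: eq_bigr => i _; rewrite ffunE incM -mulrA.
Qed.

Lemma assemble_w p : assemble (adj_w p) = W * assemble p.
Proof.
rewrite /assemble /= linear0 add0r !mulrDr; congr (_ + _).
  by rewrite !W_central -mulrA W_sqr mulr0 addr0.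
rewrite mulr_sumr; apply: eq_bigr => i _; rewrite ffunE mulrA W_central.
by rewrite -mulrA WGam mulrA -incM w_central.
Qed.

Lemma assemble_g i p : assemble (adj_g i p) = Gam i * assemble p.
Proof.
rewrite /assemble /= linear0 add0r mul0r add0r !mulrDr.
under eq_bigr => t _ do rewrite ffunE linearD linearZ /= mulrDl incM -scalerAl.
rewrite big_split /= [X in _ + X](big_only1 i) => // [|t /negPf ti _]; last first.
  by rewrite ti scale0r.
rewrite eqxx scale1r /adj_coef linearB linearD incM /= mulrBl mulrDl -mulrA -WGam.
rewrite [Gam i * inc _]Gam_supercomm [Gam i * (_ * W)]mulrA Gam_supercomm.
rewrite -[_ * Gam i * W]mulrA -[Gam i * W]W_central.
rewrite [LHS]addrC -!addrA; congr (_ + (_ + _)).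
rewrite linear_sum mulr_suml mulr_sumr -sumrN -big_split /=; apply: eq_bigr => t _.
rewrite [RHS]mulrA Gam_supercomm -[RHS]mulrA Gam_arnold mulrBr !mulrA -!incM.
by rewrite addrC.
Qed.
End AdjoinPoint.

(** * The inclusion of E(n) into E(n+1) *)

Section ForgetPoint.
Variable n : nat.
Local Notation E := (krizE n).
Local Notation E' := (krizE n.+1).
Local Notation old := (lift ord_max).
Local Notation new := (@ord_max n).
Local Notation M := (E * E * {ffun 'I_n -> E})%type.

Lemma mulr_is_linear (R : algType rat) (a : R) : linear ( *%R a).
Proof. by move=> c x y; rewrite mulrDr scalerAr. Qed.

Definition inc_w (i : 'I_n) (y : E') : E' := Ew (old i) * y.
Definition inc_g (i j : 'I_n) (y : E') : E' := Eg (old i) (old j) * y.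

Lemma inc_action : kriz_action inc_w inc_g.
Proof.
rewrite /inc_w /inc_g; split.
- by move=> i; apply: mulr_is_linear.
- by move=> i j _; apply: mulr_is_linear.
- by move=> i j p; rewrite !mulrA (EwC (old i)).
- by move=> i p; rewrite mulrA Ew_sqr mul0r.
- by move=> i j k p _; rewrite !mulrA EwC.
- by move=> i j k l p _ _; rewrite !mulrA EgC mulNr.
- by move=> i j p _; rewrite Eg_sym.
- by move=> i j p _; rewrite !mulrA -Ewg.
- by move=> i j k p _ _; rewrite !mulrA -mulrBl -Earnold.
Qed.

(** The relations of E(n) hold in E(n+1) as relations between left multiplications; the algebra map
    is the orbit map of 1 under the resulting action. *)
Definition inc (x : E) : E' := kriz_act inc_w inc_g x 1.

Lemma inc_linear : linear inc.
Proof. by move=> c x y; rewrite /inc kriz_actPl. Qed.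
HB.instance Definition _ := GRing.isLinear.Build rat E E' *:%R inc inc_linear.

Lemma inc1 : inc 1 = 1.
Proof. exact: kriz_act1 inc_action _. Qed.

Lemma inc_wM i x : inc (Ew i * x) = Ew (old i) * inc x.
Proof. by rewrite /inc (kriz_actM inc_action) (kriz_act_w inc_action). Qed.

Lemma inc_gM i j x : i != j -> inc (Eg i j * x) = Eg (old i) (old j) * inc x.
Proof. by move=> ij; rewrite /inc (kriz_actM inc_action) (kriz_act_g inc_action). Qed.

Lemma incM x y : inc (x * y) = inc x * inc y.
Proof.
elim/krizE_genind: x => [c x x' IH IH'|||i x IH|i j x ij IH].
- by rewrite mulrDl -scalerAl !linearP /= IH IH' mulrDl -scalerAl.
- by rewrite mul0r linear0 mul0r.
- by rewrite inc1 !mul1r.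
- by rewrite -mulrA !inc_wM IH mulrA.
- by rewrite -mulrA !(inc_gM _ ij) IH mulrA.
Qed.

Lemma inc_w_gen i : inc (Ew i) = Ew (old i).
Proof. by rewrite -[Ew i]mulr1 inc_wM inc1 mulr1. Qed.

Lemma inc_g_gen i j : inc (Eg i j) = Eg (old i) (old j).
Proof.
have [->|ij] := eqVneq i j; first by rewrite !Eg_diag linear0.
by rewrite -[Eg i j]mulr1 (inc_gM _ ij) inc1 mulr1.
Qed.

Lemma inc_par x : inc (Epar n x) = Epar n.+1 (inc x).
Proof.
elim/krizE_genind: x => [c x x' IH IH'|||i x IH|i j x ij IH].
- by rewrite !linearP /= IH IH'.
- by rewrite !linear0.
- by rewrite Epar1 inc1 Epar1.
- by rewrite inc_wM !EparM !Epar_w inc_wM IH.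
- by rewrite (inc_gM _ ij) !EparM !Epar_g !mulNr linearN /= (inc_gM _ ij) IH.
Qed.

Lemma inc_d x : inc (kriz_d n x) = kriz_d n.+1 (inc x).
Proof.
elim/krizE_genind: x => [c x x' IH IH'|||i x IH|i j x ij IH].
- by rewrite !linearP /= IH IH'.
- by rewrite !linear0.
- by rewrite Ed1 inc1 Ed1 linear0.
- by rewrite inc_wM !Ed_leibniz !Ed_w !Epar_w !mul0r !add0r inc_wM IH.
rewrite (inc_gM _ ij) !Ed_leibniz !Ed_g ?(inj_eq lift_inj) // !Epar_g !mulNr linearB /=.
by rewrite (inc_gM _ ij) IH incM linearD /= !inc_w_gen.
Qed.

End ForgetPoint.

(* The inclusion E(n) -> E(n+1) is used through this interface only, since unification
   would otherwise unfold it. *)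
Record point_inclusion n (inc : krizE n -> krizE n.+1) : Prop := PointInclusion {
  inclusion1 : inc 1 = 1;
  inclusionM : forall x y, inc (x * y) = inc x * inc y;
  inclusion_w : forall i, inc (Ew i) = Ew (lift ord_max i);
  inclusion_g : forall i j, inc (Eg i j) = Eg (lift ord_max i) (lift ord_max j);
  inclusion_par : forall x, inc (Epar n x) = Epar n.+1 (inc x);
  inclusion_d : forall x, inc (kriz_d n x) = kriz_d n.+1 (inc x) }.

Lemma point_inclusion_exists n :
  exists inc : {linear krizE n -> krizE n.+1}, point_inclusion inc.
Proof.
exists (inc (n:=n)); split.
- exact: inc1.
- exact: incM.
- exact: inc_w_gen.
- exact: inc_g_gen.
- exact: inc_par.
- exact: inc_d.
Qed.

(** * Coordinates on E(n+1) *)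

Section AdjoinLast.
Variable n : nat.
Local Notation E := (krizE n).
Local Notation E' := (krizE n.+1).
Local Notation old := (lift ord_max).
Local Notation new := (@ord_max n).
Local Notation M := (E * E * {ffun 'I_n -> E})%type.

Let old_neq (i j : 'I_n) : i != j -> old i != old j.
Proof. by rewrite (inj_eq lift_inj). Qed.
Let old_new (i : 'I_n) : old i != new.
Proof. by rewrite eq_sym neq_lift. Qed.

Let adjw := adjoin_w (@Ew n).
Let adjg := adjoin_g (@Ew n) (@Eg n) (Epar n).

Lemma adj_action : kriz_action adjw adjg.
Proof.
have parP : linear (Epar n) by move=> x y z; rewrite linearP.
exact: (adj_kriz_action parP (@EparM n) (@EparK n) (@Epar_w n) (@Epar_g n)
  (@EwC n) (@Ew_sqr n) (@Eg_supercomm n) (@Eg_sym n) (@Ewg n) (@Earnold n)).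
Qed.

Variable inc : {linear E -> E'}.
Hypothesis incP : point_inclusion inc.
Let inc1 := inclusion1 incP.
Let incM := inclusionM incP.
Let inc_w_gen := inclusion_w incP.
Let inc_g_gen := inclusion_g incP.
Let inc_par := inclusion_par incP.

Lemma act_inc x p : kriz_act adjw adjg (inc x) p = adj_mul x p.
Proof.
elim/krizE_genind: x p => [c x y IHx IHy|||i x IH|i j x ij IH] p.
- by rewrite linearP kriz_actPl IHx IHy adj_mulPl.
- by rewrite linear0 adj_mul0 kriz_act0l.
- by rewrite inc1 (kriz_act1 adj_action) adj_mul1.
- rewrite incM inc_w_gen !(kriz_actM adj_action) (kriz_act_w adj_action) IH.
  by rewrite /adjw /adjoin_w liftK adj_mulA.
rewrite incM inc_g_gen !(kriz_actM adj_action) (kriz_act_g adj_action) ?old_neq //.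
by rewrite /adjg /adjoin_g !liftK IH adj_mulA.
Qed.

(** The free-module version of x times 1. It is well defined on the quotient because the operators
    satisfy the relations of E(n+1). *)
Definition coords (x : E') : M := kriz_act adjw adjg x (1, 0, 0).

Lemma coords_linear : linear coords.
Proof. by move=> c x y; rewrite /coords kriz_actPl. Qed.
HB.instance Definition _ := GRing.isLinear.Build rat E' M *:%R coords coords_linear.

Lemma coords0 : coords 0 = 0.
Proof. exact: kriz_act0l. Qed.

Lemma coords_inc_mul x z : coords (inc x * z) = adj_mul x (coords z).
Proof. by rewrite /coords (kriz_actM adj_action) act_inc. Qed.

Lemma coords1 : coords 1 = (1, 0, 0).
Proof. exact: (kriz_act1 adj_action). Qed.

Lemma coords_new_w : coords (Ew new) = (0, 1, 0).
Proof.
rewrite /coords (kriz_act_w adj_action) /adjw /adjoin_w unlift_none.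
by apply: adjP => [||j] //=; rewrite !ffunE mulr0.
Qed.

Lemma coords_new_g i :
  coords (Eg (old i) new) = (0, 0, [ffun j => (j == i)%:R *: 1]).
Proof.
rewrite /coords (kriz_act_g adj_action) ?old_new // /adjg /adjoin_g unlift_none liftK.
apply: adjP => [||j] //=; rewrite !ffunE linear0 mul0r add0r; congr (_ *: _).
rewrite /adj_coef /= Epar1 linear0 mul0r addr0 big1 ?subr0 // => t _.
by rewrite ffunE linear0 mul0r.
Qed.

(** This half gives the linear independence of 1, w_new and the G_(i,new) over E(n). *)
Lemma coords_assemble p :
  coords (assemble inc (Ew new) (fun i : 'I_n => Eg (old i) new) p) = p.
Proof.
rewrite /assemble !linearD linear_sum /= -[inc p.1.1]mulr1 !coords_inc_mul coords1.
rewrite coords_new_w.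
have M11 (F : 'I_n -> M) : (\sum_i F i).1.1 = \sum_i (F i).1.1.
  exact: (big_morph (fun q : M => q.1.1)).
have M12 (F : 'I_n -> M) : (\sum_i F i).1.2 = \sum_i (F i).1.2.
  exact: (big_morph (fun q : M => q.1.2)).
have M2 (F : 'I_n -> M) j : (\sum_i F i).2 j = \sum_i (F i).2 j.
  by apply: (big_morph (fun q : M => q.2 j)) => [q q'|]; rewrite ffunE.
apply: adjP => [||j].
- rewrite /= M11 big1 ?addr0 ?mulr1 ?mulr0 ?addr0 // => i _.
  by rewrite coords_inc_mul coords_new_g /= mulr0.
- rewrite /= M12 big1 ?addr0 ?mulr1 ?mulr0 ?add0r // => i _.
  by rewrite coords_inc_mul coords_new_g /= mulr0.
rewrite /= !ffunE /= !mulr0 !add0r M2 (big_only1 j) // => [|i ij _].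
  by rewrite coords_inc_mul coords_new_g /= !ffunE eqxx scale1r mulr1.
by rewrite coords_inc_mul coords_new_g /= !ffunE eq_sym (negPf ij) scale0r mulr0.
Qed.

(** Both sides can be compared on generators, where the operators were read off from E(n+1). At p =
    (1, 0, 0) this yields the spanning half, [assemble_coords]. *)
Lemma assemble_act x p :
  assemble inc (Ew new) (fun i : 'I_n => Eg (old i) new) (kriz_act adjw adjg x p)
  = x * assemble inc (Ew new) (fun i : 'I_n => Eg (old i) new) p.
Proof.
set asm := assemble _ _ _.
have asm_mul b q : asm (adj_mul b q) = inc b * asm q.
  exact: (assemble_mul _ _ incM).
have wGam i : Ew new * Eg (old i) new = inc (Ew i) * Eg (old i) new.
  by rewrite inc_w_gen -Ewg.
have Gam_super i y : Eg (old i) new * inc y = inc (Epar n y) * Eg (old i) new.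
  by rewrite Eg_supercomm inc_par.
have Gam_arnold i t : Eg (old i) new * Eg (old t) new =
    inc (Eg i t) * Eg (old t) new - inc (Eg i t) * Eg (old i) new.
  by rewrite Earnold inc_g_gen.
have asm_w q : asm (adj_w (@Ew n) q) = Ew new * asm q.
  exact: (assemble_w (@EwC n) incM (EwC new) (Ew_sqr new) wGam).
have asm_g i q : asm (adj_g (@Ew n) (@Eg n) (Epar n) i q) = Eg (old i) new * asm q.
  exact: (assemble_g incM (EwC new) wGam Gam_super Gam_arnold).
have asm_lin : linear asm by exact: assemble_linear.
have asm0 : asm 0 = 0 by have := asm_lin (-1) 0 0; rewrite scaler0 addr0 scaleN1r addNr.
clearbody asm; elim/krizE_genind: x => [c x y IHx IHy|||i x IH|i j x ij IH].
- by rewrite kriz_actPl asm_lin IHx IHy mulrDl -scalerAl.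
- by rewrite kriz_act0l asm0 mul0r.
- by rewrite (kriz_act1 adj_action) mul1r.
- rewrite (kriz_actM adj_action) (kriz_act_w adj_action) -mulrA -IH.
  move: (kriz_act adjw adjg x p) => q; rewrite /adjw /adjoin_w.
  case: unliftP => [k ->|->]; last exact: asm_w.
  by rewrite asm_mul inc_w_gen.
rewrite (kriz_actM adj_action) (kriz_act_g adj_action) // -mulrA -IH.
move: (kriz_act adjw adjg x p) => q; rewrite /adjg /adjoin_g.
case: unliftP ij => [k ->|->]; case: unliftP => [l ->|->] kl.
- by rewrite asm_mul inc_g_gen.
- by rewrite asm_g.
- by rewrite asm_g Eg_sym.
by rewrite eqxx in kl.
Qed.

Lemma assemble_coords x :
  assemble inc (Ew new) (fun i : 'I_n => Eg (old i) new) (coords x) = x.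
Proof.
rewrite /coords assemble_act /assemble /= inc1 linear0 mul0r addr0 big1 ?addr0 ?mulr1 //.
by move=> i _; rewrite ffunE linear0 mul0r.
Qed.
End AdjoinLast.

(** * Cohomology of a free extension *)

(** Stated for the whole complex; bidegrees come back in [betti_coh_basis]. *)
Record coh_basis (V : vectType rat) (d : 'End(V)) (T : finType) (c : T -> V) : Prop :=
  CohBasis {
    coh_cycle : forall t, d (c t) = 0;
    coh_gen : forall z, d z = 0 ->
      exists a : T -> rat, exists y, z = \sum_t a t *: c t + d y;
    coh_free : forall (a : T -> rat) y, \sum_t a t *: c t = d y -> forall t, a t = 0 }.

Lemma bool_sum (V : lmodType rat) (a : bool -> rat) (y1 y2 : V) :
  \sum_b a b *: (if b then y1 else y2) = a true *: y1 + a false *: y2.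
Proof. by rewrite (bigD1 true) //= (big_only1 false) // => -[]. Qed.

Section FreeExtension.
Variables (B E : falgType rat) (dB par : 'End(B)) (dE : 'End(E)).
Variables (inc : {linear B -> E}) (U G : E) (J : finType) (g : J -> E) (h : J -> B).
Hypothesis inc1 : inc 1 = 1.
Hypothesis incM : forall x y, inc (x * y) = inc x * inc y.
Hypothesis parK : involutive par.
Hypothesis dE_inc : forall x, dE (inc x) = inc (dB x).
Hypothesis dE_incM : forall x y, dE (inc x * y) = inc (dB x) * y + inc (par x) * dE y.
Hypothesis dE_sqr : forall X, dE (dE X) = 0.
Hypothesis dG : dE G = U.
Hypothesis dg : forall j, dE (g j) = inc (h j).

Let dU : dE U = 0. Proof. by rewrite -dG dE_sqr. Qed.

(* As d G = U, the terms in U and G form an acyclic summand. *)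
Definition ext_comb (x y z : B) (m : J -> B) : E :=
  inc x + inc y * U + inc z * G + \sum_j inc (m j) * g j.

Hypothesis ext_gen : forall X, exists x y z m, X = ext_comb x y z m.
Hypothesis ext_free : forall x y z m, ext_comb x y z m = 0 ->
  [/\ x = 0, y = 0, z = 0 & forall j, m j = 0].

Lemma eq_ext_comb x y z m m' : m =1 m' -> ext_comb x y z m = ext_comb x y z m'.
Proof. by move=> mm'; congr (_ + _); apply: eq_bigr => j _; rewrite mm'. Qed.

Lemma ext_combB x y z m x' y' z' m' :
  ext_comb x y z m - ext_comb x' y' z' m' =
  ext_comb (x - x') (y - y') (z - z') (fun j => m j - m' j).
Proof.
rewrite /ext_comb !linearB /= !mulrBl !opprD; rewrite [LHS]addrACA; congr (_ + _).
  by rewrite [LHS]addrACA [X in X + _ = _]addrACA.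
by rewrite -sumrB; apply: eq_bigr => j _; rewrite linearB mulrBl.
Qed.

Lemma ext_comb_inj x y z m x' y' z' m' :
  ext_comb x y z m = ext_comb x' y' z' m' ->
  [/\ x = x', y = y', z = z' & m =1 m'].
Proof.
move=> /eqP; rewrite -subr_eq0 ext_combB => /eqP/ext_free[x0 y0 z0 m0].
by split; try move=> j; apply/eqP; rewrite -subr_eq0 ?x0 ?y0 ?z0 ?m0.
Qed.

Lemma ext_d x y z m : dE (ext_comb x y z m) =
  ext_comb (dB x + \sum_j par (m j) * h j) (dB y + par z) (dB z) (fun j => dB (m j)).
Proof.
rewrite /ext_comb !linearD /= linear_sum /= dE_inc !dE_incM dU dG mulr0 addr0.
under eq_bigr => j _ do rewrite dE_incM dg.
rewrite big_split /= linear_sum /= mulrDl.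
under [\sum_j inc (_ * h _)]eq_bigr => j _ do rewrite incM.
by rewrite [LHS](AC (2*2*2) (1*6*(2*4)*3*5)).
Qed.

Lemma ext_cycle X : dE X = 0 -> exists x m Y,
  [/\ X = ext_comb x 0 0 m + dE Y, dB x + \sum_j par (m j) * h j = 0
    & forall j, dB (m j) = 0].
Proof.
have [x [y [z [m XE]]]] := ext_gen X => dX.
(* The boundary of par(y) G has U-coefficient y, as [par] is an involution. Splitting it off removes
   the U-term and otherwise changes only the G-coefficient. *)
have {}XE : X = ext_comb x 0 (z - dB (par y)) m + dE (inc (par y) * G).
  rewrite XE dE_incM dG parK /ext_comb linearB /= mulrBl linear0 mul0r addr0.
  by rewrite [RHS](AC (3*2) (1*5*(2*4)*3)) /= subrK.
(* Without a U-term, the U-coefficient of the differential is [par] of the G-coefficient, which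
   therefore vanishes. *)
move: dX; rewrite XE linearD /= dE_sqr addr0 ext_d => /ext_free[dx].
rewrite linear0 add0r => /(congr1 par); rewrite parK linear0 => z0 _ dm.
by exists x, m, (inc (par y) * G); rewrite z0.
Qed.

Lemma ext_boundary x m Y : ext_comb x 0 0 m = dE Y ->
  exists x' m', x = dB x' + \sum_j par (m' j) * h j /\ forall j, m j = dB (m' j).
Proof.
have [x' [y [z [m' ->]]]] := ext_gen Y; rewrite ext_d => /ext_comb_inj[-> _ _ mE].
by exists x', m'.
Qed.

Lemma ext_comb_d x m : ext_comb (dB x + \sum_j par (m j) * h j) 0 0 (fun j => dB (m j))
  = dE (ext_comb x 0 0 m).
Proof. by rewrite ext_d !linear0 addr0. Qed.

Lemma ext_combD x m x' m' : ext_comb x 0 0 m + ext_comb x' 0 0 m' =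
  ext_comb (x + x') 0 0 (fun j => m j + m' j).
Proof.
rewrite /ext_comb !linear0 !mul0r !addr0 linearD [LHS]addrACA; congr (_ + _).
by rewrite -big_split; apply: eq_bigr => j _; rewrite linearD mulrDl.
Qed.

Section ClosedGenerators.
Hypothesis h0 : forall j, h j = 0.
Variables (T : finType) (c : T -> B).
Hypothesis cP : coh_basis dB c.

Let sum_h m : \sum_j par (m j) * h j = 0.
Proof. by apply: big1 => j _; rewrite h0 mulr0. Qed.

Definition ext_class (t : T + J * T) : E :=
  match t with inl t => inc (c t) | inr (j, t) => inc (c t) * g j end.

Lemma ext_class_sum (a : T + J * T -> rat) : \sum_t a t *: ext_class t =
  ext_comb (\sum_t a (inl t) *: c t) 0 0 (fun j => \sum_t a (inr (j, t)) *: c t).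
Proof.
rewrite big_sumType /= /ext_comb !linear0 !mul0r !addr0 linear_sum /=; congr (_ + _).
  by apply: eq_bigr => t _; rewrite linearZ.
rewrite (eq_bigr (fun p => a (inr (p.1, p.2)) *: (inc (c p.2) * g p.1))); last by case.
rewrite -(pair_bigA _ (fun j t => a (inr (j, t)) *: (inc (c t) * g j))) /=.
apply: eq_bigr => j _; rewrite linear_sum mulr_suml; apply: eq_bigr => t _.
by rewrite linearZ scalerAl.
Qed.

Lemma ext_coh_basis : coh_basis dE ext_class.
Proof.
split.
- case=> [t|[j t]] /=; rewrite ?dE_inc ?dE_incM (coh_cycle cP) ?linear0 // dg h0.
  by rewrite linear0 mulr0 mul0r addr0.
- move=> Z /ext_cycle[x [m [Y [ZE]]]]; rewrite sum_h addr0 => dx dm.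
  have [a [x' xE]] := coh_gen cP dx.
  have /fin_all_exists[b /fin_all_exists[m' mE]] j := coh_gen cP (dm j).
  exists (fun t => match t with inl t => a t | inr (j, t) => b j t end).
  exists (ext_comb x' 0 0 m' + Y).
  rewrite ZE ext_class_sum linearD /= addrA; congr (_ + _).
  rewrite -ext_comb_d sum_h addr0 ext_combD -xE; apply: eq_ext_comb => j.
  by rewrite /= mE.
move=> a Y; rewrite ext_class_sum => /ext_boundary[x' [m' []]].
rewrite sum_h addr0 => xE mE [t|[j t]].
  exact: (coh_free cP xE).
exact: (coh_free cP (mE j)).
Qed.
End ClosedGenerators.

(* The cone of the multiplication by h = r v on a cohomology with basis 1, v, v^2 = 0. *)
Section EulerClass.
Hypothesis par1 : par 1 = 1.
Hypothesis dB_leibniz : forall x y, dB (x * y) = dB x * y + par x * dB y.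
Hypothesis dB_par : forall x, dB (par x) = - par (dB x).
Variables (v : B) (r : rat) (j0 : J).
Hypothesis r_neq0 : r != 0.
Hypothesis par_v : par v = v.
Hypothesis v_sqr : v * v = 0.
Hypothesis J1 : forall j, j = j0.
Hypothesis h_v : h j0 = r *: v.
Hypothesis cP : coh_basis dB (fun b : bool => if b then v else 1).

Let dv : dB v = 0. Proof. exact: (coh_cycle cP true). Qed.

(** Multiplication by v only sees the component of m along 1: v^2 = 0 kills the other one, and since
    dv = 0 the boundary part stays a boundary, with the sign of [dB_par]. *)
Lemma cycle_mul_v m : dB m = 0 -> exists a b m',
  m = b *: v + a *: 1 + dB m' /\ par m * v = a *: v - dB (par m' * v).
Proof.
move=> /(coh_gen cP)[a [m' ->]]; rewrite bool_sum.
exists (a false), (a true), m'; split=> //.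
rewrite !linearD !linearZ /= par_v par1 !mulrDl -!scalerAl v_sqr scaler0 add0r mul1r.
by rewrite dB_leibniz dv mulr0 addr0 dB_par mulNr opprK.
Qed.

Let sum_h m : \sum_j par (m j) * h j = r *: (par (m j0) * v).
Proof. by rewrite (big_only1 j0) => // [|j]; rewrite ?h_v ?scalerAr // (J1 j) eqxx. Qed.

Lemma euler_coh_basis :
  coh_basis dE (fun b : bool => if b then inc v * g j0 else 1).
Proof.
have one_comb a b : b *: (inc v * g j0) + a *: 1 = ext_comb (a *: 1) 0 0 (fun=> b *: v).
  rewrite /ext_comb (big_only1 j0) // => [|j]; last by rewrite (J1 j) eqxx.
  by rewrite !linear0 !mul0r !addr0 addrC !linearZ /= inc1 scalerAl.
split.
- case; last by rewrite -inc1 dE_inc (coh_cycle cP false) linear0.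
  by rewrite dE_incM dv dg h_v linear0 mul0r add0r -incM par_v -scalerAr v_sqr scaler0 linear0.
- move=> Z /ext_cycle[x [m [Y [-> dx dm]]]].
  have [a [b [m' [mE mvE]]]] := cycle_mul_v (dm j0).
  move: dx; rewrite sum_h mvE => dx.
  (* The cycle condition makes r a v the boundary of r par(m') v - x; independence of the class of v
     and r != 0 force a = 0. *)
  have a0 : a = 0.
    have := @coh_free _ _ _ _ cP (fun t => if t then r * a else 0) (r *: (par m' * v) - x).
    rewrite bool_sum scale0r addr0 => /(_ _ true)/eqP.
    rewrite mulf_eq0 (negPf r_neq0) => /(_ _)/eqP-> //.
    rewrite linearB linearZ /= -[RHS]addr0 -dx scalerBr scalerA.
    by rewrite addrA subrK addrC subrK.
  rewrite a0 !scale0r add0r in mE dx; rewrite addr0 in mE.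
  have /(coh_gen cP)[a' [x' xE]] : dB (x - r *: (par m' * v)) = 0.
    by rewrite linearB linearZ /= -scalerN.
  rewrite /= bool_sum in xE.
  exists (fun t => if t then b else a' false).
  (* The boundary of (a' true / r) g is a' true v, which absorbs the v-component of x. *)
  exists (ext_comb x' 0 0 (fun=> m' + (a' true / r) *: 1) + Y).
  rewrite bool_sum one_comb linearD /= addrA -ext_comb_d ext_combD; congr (_ + _).
  have -> : x = a' false *: 1 + (dB x' + \sum_j par (m' + (a' true / r) *: 1) * h j).
    rewrite (big_only1 j0) // => [|j]; last by rewrite (J1 j) eqxx.
    rewrite linearD linearZ /= par1 h_v mulrDl -!scalerAr -!scalerAl mul1r scalerA.
    rewrite [r * _]mulrC divfK // -[LHS](subrK (r *: (par m' * v))) xE.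
    by rewrite [LHS](AC (2*1*1) (2*(3*(4*1)))).
  apply: eq_ext_comb => j; rewrite (J1 j) mE linearD linearZ /=.
  by rewrite (coh_cycle cP false) scaler0 addr0.
move=> a Y; rewrite bool_sum one_comb => /ext_boundary[x [m [xE mE]]].
have b0 : a true = 0.
  have := @coh_free _ _ _ _ cP (fun t => if t then a true else 0) (m j0).
  by rewrite bool_sum scale0r addr0 => /(_ (mE j0) true).
have /cycle_mul_v[al [be [m' [_ mv]]]] : dB (m j0) = 0.
  by rewrite -(mE j0) b0 scale0r.
(* The relation now reads a false - r al v = d(x - r par(m') v), and the classes of 1 and v are
   independent. *)
have := @coh_free _ _ _ _ cP (fun t => if t then - (r * al) else a false)
  (x - r *: (par m' * v)).
have dR : dB (x - r *: (par m' * v)) = dB x - r *: dB (par m' * v).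
  by rewrite linearB linearZ.
rewrite bool_sum /= xE sum_h mv dR scalerBr scalerA scaleNr addrCA addKr.
by move=> /(_ erefl false) a0; case; [exact: b0|exact: a0].
Qed.
End EulerClass.
End FreeExtension.

(** * Change of basis in the free module *)

Section ChangeOfBasis.
Variables (p : nat) (B E : falgType rat) (inc : {linear B -> E}).
Variables (W : E) (Gam : 'I_p.+1 -> E) (w0 : B) (h : 'I_p -> B).
Hypothesis incM : forall x y, inc (x * y) = inc x * inc y.

Definition shifted_w : E := W + inc w0.
Definition shifted_g (j : 'I_p) : E := Gam (lift ord0 j) - Gam ord0 - inc (h j).
Local Notation comb := (ext_comb inc shifted_w (Gam ord0) shifted_g).
Local Notation asm := (assemble inc W Gam).

(** The change of basis is unitriangular: [w0] and [h] alter only the coordinate of 1, and the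
    differences of the [Gam] alter only the coordinate of [Gam ord0]. *)
Lemma ext_comb_assemble x y z m : comb x y z m =
  asm (x + y * w0 - \sum_j m j * h j, y,
       [ffun i => if unlift ord0 i is Some j then m j else z - \sum_j m j]).
Proof.
rewrite /assemble /= big_ord_recl ffunE unlift_none.
rewrite [X in _ = _ + (_ + X)](eq_bigr (fun j => inc (m j) * Gam (lift ord0 j))); last first.
  by move=> j _; rewrite ffunE liftK.
rewrite /ext_comb /shifted_w /shifted_g.
under [X in _ + X = _]eq_bigr => j _ do rewrite !mulrBr -incM.
rewrite !sumrB -mulr_suml -!linear_sum !linearB linearD mulrBl mulrDr incM /=.
by rewrite [LHS](AC (1*2*1*3) ((1*3*7)*2*((4*6)*5))).
Qed.

Hypothesis asm_surj : forall X, exists P, X = asm P.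
Hypothesis asm_inj : forall P, asm P = 0 -> P = 0.

Lemma shifted_gen X : exists x y z m, X = comb x y z m.
Proof.
have [[[x y] m] ->] := asm_surj X.
exists (x - y * w0 + \sum_j m (lift ord0 j) * h j), y.
exists (m ord0 + \sum_j m (lift ord0 j)), (fun j => m (lift ord0 j)).
rewrite ext_comb_assemble; congr asm; apply: adjP => [||i] //=.
  by rewrite addrAC addrK subrK.
by rewrite ffunE; case: unliftP => [j ->|->] //; rewrite addrK.
Qed.

Lemma shifted_free x y z m : comb x y z m = 0 ->
  [/\ x = 0, y = 0, z = 0 & forall j, m j = 0].
Proof.
rewrite ext_comb_assemble => /asm_inj P0.
have coord1 := congr1 (fun P : B * B * {ffun 'I_p.+1 -> B} => P.1.1) P0.
have coord2 := congr1 (fun P : B * B * {ffun 'I_p.+1 -> B} => P.1.2) P0.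
have coord3 i := congr1 (fun P : B * B * {ffun 'I_p.+1 -> B} => P.2 i) P0.
have y0 : y = 0 by exact: coord2.
have m0 j : m j = 0 by have := coord3 (lift ord0 j); rewrite /= !ffunE liftK.
have z0 := coord3 ord0; rewrite /= !ffunE unlift_none big1 ?subr0 // in z0.
split=> //; rewrite /= y0 mul0r addr0 big1 ?subr0 // in coord1.
by move=> j _; rewrite m0 mul0r.
Qed.
End ChangeOfBasis.

(** * The step from E(p+1) to E(p+2) *)

Section AddPoint.
Variables (p : nat) (inc : {linear krizE p.+1 -> krizE p.+2}).
Hypothesis incP : point_inclusion inc.
Variable h : 'I_p -> krizE p.+1.
Local Notation old := (lift (@ord_max p.+1)).
Local Notation new := (@ord_max p.+1).
Local Notation d := (kriz_d p.+1).
Local Notation d' := (kriz_d p.+2).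
Local Notation Gam := (fun i : 'I_p.+1 => Eg (old i) new).

Definition add_g : 'I_p -> krizE p.+2 := shifted_g inc Gam h.
Definition add_U : krizE p.+2 := shifted_w inc (Ew new) (Ew ord0).
(** The correction [h] is left free: from three old points on it is chosen to make [add_h] vanish,
    for two old points to leave -2 w_1. *)
Definition add_h (j : 'I_p) : krizE p.+1 := Ew (lift ord0 j) - Ew ord0 - d (h j).

Let old_new (i : 'I_p.+1) : old i != new.
Proof. by rewrite eq_sym neq_lift. Qed.

Lemma add_dG : d' (Gam ord0) = add_U.
Proof. by rewrite Ed_g // addrC -(inclusion_w incP). Qed.

Lemma add_dg j : d' (add_g j) = inc (add_h j).
Proof.
rewrite /add_g /shifted_g !linearB /= !Ed_g // (inclusion_d incP) !(inclusion_w incP).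
by rewrite [Ew (old ord0) + _]addrC addrKA.
Qed.

Lemma add_dM x y : d' (inc x * y) = inc (d x) * y + inc (Epar _ x) * d' y.
Proof. by rewrite Ed_leibniz (inclusion_d incP) (inclusion_par incP). Qed.

Lemma add_gen X : exists x y z m, X = ext_comb inc add_U (Gam ord0) add_g x y z m.
Proof.
apply: shifted_gen (inclusionM incP) _ X => X.
by exists (coords X); rewrite (assemble_coords incP).
Qed.

Lemma add_free x y z m : ext_comb inc add_U (Gam ord0) add_g x y z m = 0 ->
  [/\ x = 0, y = 0, z = 0 & forall j, m j = 0].
Proof.
have inj P : assemble inc (Ew new) Gam P = 0 -> P = 0.
  move=> P0; have := congr1 (@coords p.+1) P0.
  exact: (fun e => etrans (esym (coords_assemble incP P)) (etrans e (coords0 _))).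
exact: (shifted_free (inclusionM incP) inj).
Qed.

Lemma add_coh_basis (T : finType) (c : T -> krizE p.+1) :
  (forall j, add_h j = 0) -> coh_basis d c -> coh_basis d' (ext_class inc add_g c).
Proof.
move=> h0 cP.
have parK : involutive (Epar p.+1) := @EparK _.
have dI x : d' (inc x) = inc (d x) by rewrite (inclusion_d incP).
have dd X : d' (d' X) = 0 by apply: kriz_d_sqr.
exact: (ext_coh_basis (inclusionM incP) parK dI add_dM dd add_dG add_dg
  add_gen add_free h0 cP).
Qed.
End AddPoint.

(** * The bigrading *)

Section Grading.
Variable n : nat.
Local Notation A := (krizA n).
Local Notation E := (krizE n).
Implicit Types (S T : {set 'I_n + edge n}) (u v : A) (x y : E) (k q : nat).

Lemma krizA_comp_mon k q S : upper_degree S = k -> #|odd_part S| = q ->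
  (mon S : A) \in krizA_comp n k q.
Proof. by move=> <- <-; apply: mem_krizA_comp. Qed.

Lemma degree0 : upper_degree (set0 : {set 'I_n + edge n}) = 0%N /\
  #|odd_part (set0 : {set 'I_n + edge n})| = 0%N.
Proof.
have e0 : even_part (set0 : {set 'I_n + edge n}) = set0 by apply/setP => i; rewrite !inE.
have o0 : odd_part (set0 : {set 'I_n + edge n}) = set0 by apply/setP => i; rewrite !inE.
by rewrite /upper_degree e0 o0 !cards0.
Qed.

Lemma krizA_comp1 : (1 : A) \in krizA_comp n 0 0.
Proof. by apply: krizA_comp_mon; have [] := degree0. Qed.

Lemma krizA_comp_mul k q k' q' u v : u \in krizA_comp n k q ->
  v \in krizA_comp n k' q' -> u * v \in krizA_comp n (k + k') (q + q').
Proof.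
move=> uk vk; have -> : u * v = amull u v by rewrite lfunE.
rewrite memv_preim; apply: subvP vk; apply: krizA_compP => T Tk Tq.
rewrite -memv_preim lfunE /=.
have -> : u * mon T = amulr (mon T : A) u by rewrite lfunE.
rewrite memv_preim; apply: subvP uk; apply: krizA_compP => S Sk Sq.
rewrite -memv_preim lfunE /= gcM_mon /monM; case: ifP => ST; last exact: mem0v.
have eU : even_part (S :|: T) = even_part S :|: even_part T.
  by apply/setP => i; rewrite !inE.
have oU : odd_part (S :|: T) = odd_part S :|: odd_part T.
  by apply/setP => i; rewrite !inE.
have dis (I : finType) (f : I -> 'I_n + edge n) :
    #|[set i | f i \in S] :|: [set i | f i \in T]| =
    (#|[set i | f i \in S]| + #|[set i | f i \in T]|)%N.
  rewrite cardsU (_ : _ :&: _ = set0) ?cards0 ?subn0 //; apply/setP => i.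
  rewrite !inE; apply/negP => /andP[iS iT].
  by have := disjointFr ST iS; rewrite iT.
apply: memvZ; apply: krizA_comp_mon; last by rewrite oU dis Sq Tq.
rewrite -Sk -Tk /upper_degree eU oU !dis mulnDr.
by rewrite addnACA.
Qed.

Lemma krizA_comp_w i : w i \in krizA_comp n 2 0.
Proof. by rewrite -[w i]mulr1; apply: w_krizA_comp; apply: krizA_comp1. Qed.

Lemma krizA_comp_G i j : G i j \in krizA_comp n 1 1.
Proof.
rewrite /G; case: insub => [e|]; last exact: mem0v.
have eo : odd_part ([set inr e] : {set 'I_n + edge n}) = [set e].
  by apply/setP => f; rewrite !inE (inj_eq inr_inj).
have ee : even_part ([set inr e] : {set 'I_n + edge n}) = set0.
  by apply/setP => f; rewrite !inE.
by apply: krizA_comp_mon; rewrite /upper_degree ?ee eo ?cards0 ?cards1.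
Qed.

Definition krizA_proj k q : 'End(A) := linfun (extend_lin (fun S =>
  if (upper_degree S == k) && (#|odd_part S| == q) then mon S else 0)).

Lemma krizA_proj_mon k q S : krizA_proj k q (mon S) =
  if (upper_degree S == k) && (#|odd_part S| == q) then mon S else 0.
Proof. by rewrite lfunE /= extend_lin_mon. Qed.

Lemma krizA_projE k q k' q' u : u \in krizA_comp n k' q' ->
  krizA_proj k q u = if (k' == k) && (q' == q) then u else 0.
Proof.
pose f : 'End(A) := if (k' == k) && (q' == q) then \1%VF else 0.
have fE v : f v = if (k' == k) && (q' == q) then v else 0.
  by rewrite /f; case: ifP => _; rewrite lfunE.
move=> uk; rewrite -fE; apply/eqP; rewrite -subr_eq0 -opp_lfunE -add_lfunE -memv_ker.
apply: subvP uk; apply: krizA_compP => S Sk Sq.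
by rewrite memv_ker add_lfunE opp_lfunE fE krizA_proj_mon Sk Sq subrr.
Qed.

(** The relations are bihomogeneous, of bidegrees (1, 1), (3, 1) and (2, 2), and their cofactors may
    be taken to be monomials. Hence the bigrading descends to E(n). *)
Lemma krizA_proj_ideal k q : (krizA_proj k q @: kriz_ideal n <= kriz_ideal n)%VS.
Proof.
apply/subvP => _ /memv_imgP[u uI ->]; rewrite memv_preim.
apply: (subvP (kriz_idealP _)) uI => a r b rR; rewrite -memv_preim.
elim/gcalg_ind: a => [c a a' IH IH'||S].
- by rewrite !mulrDl -!scalerAl linearP; apply: memvD => //; apply: memvZ.
- by rewrite !mul0r linear0 mem0v.
elim/gcalg_ind: b => [c b b' IH IH'||T].
- by rewrite mulrDr -scalerAr linearP; apply: memvD => //; apply: memvZ.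
- by rewrite mulr0 linear0 mem0v.
pose U := ((krizA_proj k q \o amulr (mon T : A) \o amull (mon S : A))%VF
  @^-1: kriz_ideal n)%VS.
have memU v : (v \in U) = (krizA_proj k q (mon S * v * mon T) \in kriz_ideal n).
  by rewrite -memv_preim !comp_lfunE [amulr _ _]lfunE [amull _ _]lfunE.
rewrite -memU.
have homU k' q' v : v \in kriz_rel n -> v \in krizA_comp n k' q' -> v \in U.
  move=> vR vk; rewrite memU.
  have vSk := krizA_comp_mul (krizA_comp_mul (mem_krizA_comp S) vk) (mem_krizA_comp T).
  rewrite (krizA_projE _ _ vSk); case: ifP => _; last exact: mem0v.
  by apply: kriz_idealMr; apply: kriz_idealMl; apply: (subvP (@kriz_rel_sub n)).
have wG i j l : w l * G i j \in krizA_comp n 3 1.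
  exact: (krizA_comp_mul (krizA_comp_w l) (krizA_comp_G i j)).
have GG i j l m : G i j * G l m \in krizA_comp n 2 2.
  exact: (krizA_comp_mul (krizA_comp_G i j) (krizA_comp_G l m)).
apply: subvP rR; apply: kriz_relP => [i j ij|i j ij|i j l ij jl].
- by apply: (homU 1 1)%N; rewrite ?kriz_rel1 // memvB ?krizA_comp_G.
- by apply: (homU 3 1)%N; rewrite ?kriz_rel2 // memvB ?wG.
- by apply: (homU 2 2)%N; rewrite ?kriz_rel3 // !memvB ?GG.
Qed.
End Grading.

Section KrizGrading.
Variable n : nat.
Local Notation A := (krizA n).
Local Notation E := (krizE n).
Implicit Types (S T : {set 'I_n + edge n}) (u v : A) (x y : E) (k q : nat).

Lemma kriz_comp_pi k q u : u \in krizA_comp n k q -> krizE_pi n u \in kriz_comp n k q.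
Proof. exact: memv_img. Qed.

Lemma kriz_comp1 : (1 : E) \in kriz_comp n 0 0.
Proof. exact: kriz_comp_pi (krizA_comp1 n). Qed.

Lemma kriz_comp_w i : Ew i \in kriz_comp n 2 0.
Proof. exact: kriz_comp_pi (krizA_comp_w i). Qed.

Lemma kriz_comp_g i j : Eg i j \in kriz_comp n 1 1.
Proof. exact: kriz_comp_pi (krizA_comp_G i j). Qed.

Lemma kriz_comp_mul k q k' q' x y : x \in kriz_comp n k q -> y \in kriz_comp n k' q' ->
  x * y \in kriz_comp n (k + k') (q + q').
Proof.
move=> /memv_imgP[u uk ->] /memv_imgP[v vk ->]; rewrite -krizE_piM.
by apply: kriz_comp_pi; apply: krizA_comp_mul.
Qed.

Definition kriz_proj k q : 'End(E) := quot_end (kriz_ideal n) (krizA_proj n k q).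

Lemma kriz_proj_pi k q u : kriz_proj k q (krizE_pi n u) = krizE_pi n (krizA_proj n k q u).
Proof. exact: (quot_endE (krizA_proj_ideal n k q)). Qed.

Lemma kriz_projE k q k' q' x : x \in kriz_comp n k' q' ->
  kriz_proj k q x = if (k' == k) && (q' == q) then x else 0.
Proof.
move=> /memv_imgP[u uk ->]; rewrite kriz_proj_pi (krizA_projE _ _ uk).
by case: ifP => // _; rewrite linear0.
Qed.

(** d is bihomogeneous on monomials, so a component of a boundary is the boundary of a component.
    This converts the ungraded [coh_gen] into a graded statement. *)
Lemma kriz_d_boundary k q x : kriz_proj k q (kriz_d n x) \in kriz_boundaries n k q.
Proof.
elim/krizE_ind: x; elim/gcalg_ind => [a u v IHu IHv||S].
- by rewrite !linearP; apply: memvD => //; apply: memvZ.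
- by rewrite !linear0 mem0v.
case Sq: #|odd_part S| => [|q'].
  rewrite kriz_d_pi /kriz_dA deriv_ofE big1 ?linear0 ?mem0v // => e _.
  rewrite contract_mon; case: ifPn => eS; last by rewrite mulr0.
  by move/cards0_eq/setP/(_ e): Sq; rewrite !inE eS.
have Sk : krizE_pi n (mon S) \in kriz_comp n (upper_degree S) q'.+1.
  by apply: kriz_comp_pi; apply: krizA_comp_mon.
rewrite (kriz_projE _ _ (kriz_comp_d Sk)); case: ifP => [/andP[/eqP<- /eqP<-]|_].
  exact: memv_img.
exact: mem0v.
Qed.

Section Betti.
Variables (T : finType) (deg : T -> nat * nat) (c : T -> E).
Hypothesis cP : coh_basis (kriz_d n) c.
Hypothesis c_deg : forall t, c t \in kriz_comp n (deg t).1 (deg t).2.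

(** The classes of bidegree (k, q) form a basis of H_q^k: projection drops the others from the
    expansion of a cycle, and a relation among these classes extends by zero coefficients to all
    classes. *)
Lemma betti_coh_basis k q : betti n k q = #|[set t | deg t == (k, q)]|.
Proof.
set P := [set t | _]; set Z := kriz_cycles n k q.
set U := (linfun (@vsval _ _ Z) @^-1: kriz_boundaries n k q)%VS.
have UP (z : subvs_of Z) : (z \in U) = (vsval z \in kriz_boundaries n k q).
  by rewrite -memv_preim lfunE.
have cZ t : t \in P -> c t \in Z.
  rewrite inE => /eqP tP; rewrite memv_cap memv_ker (coh_cycle cP) eqxx andbT.
  by have := c_deg t; rewrite tP.
pose cc t : kriz_coh n k q := quot_pi U (vsproj Z (c t)).
pose X := [tuple cc (enum_val i) | i < #|P|].
suff Xb : basis_of {: kriz_coh n k q} X by rewrite /betti (size_basis Xb).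
apply/andP; split.
  apply/eqP/vspaceP => z; rewrite memvf.
  rewrite -[z]quot_reprK; set z' := quot_repr _ _.
  have := subvsP z'; rewrite memv_cap memv_ker => /andP[zk /eqP/(coh_gen cP)[a [y zE]]].
  have {}zE : vsval z' = \sum_(t in P) a t *: c t + kriz_proj k q (kriz_d n y).
    have := kriz_projE k q zk; rewrite !eqxx /= => <-; rewrite zE linearD; congr (_ + _).
    rewrite linear_sum [RHS]big_mkcond; apply: eq_bigr => t _; rewrite linearZ /=.
    rewrite (kriz_projE _ _ (c_deg t)) inE /= -pair_eqE /=.
    by case: ifP => // _; rewrite scaler0.
  have yB := kriz_d_boundary k q y.
  rewrite -[z']vsvalK zE linearD /= linearD /=.
  have -> : quot_pi U (vsproj Z (kriz_proj k q (kriz_d n y))) = 0.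
    by apply/eqP; rewrite quot_pi_eq0 UP vsprojK // (subvP (kriz_boundaries_sub n k q)).
  rewrite addr0 !linear_sum; apply: memv_suml => t tP; rewrite !linearZ; apply: memvZ.
  have := mem_tnth (enum_rank_in tP t) X; rewrite tnth_mktuple enum_rankK_in //.
  exact: memv_span.
apply/freeP => b b0 i.
have bB : \sum_j b j *: c (enum_val j) \in kriz_boundaries n k q.
  have cP' (j : 'I_#|P|) : c (enum_val j) \in Z by apply: (cZ _ (enum_valP j)).
  have <- : vsval (\sum_j b j *: vsproj Z (c (enum_val j))) = \sum_j b j *: c (enum_val j).
    by rewrite linear_sum; apply: eq_bigr => j _; rewrite linearZ /= vsprojK.
  rewrite -UP -quot_pi_eq0 linear_sum; apply/eqP; rewrite -[RHS]b0; apply: eq_bigr => j _.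
  by rewrite linearZ nth_mktuple.
have [y yE] : exists y, \sum_j b j *: c (enum_val j) = kriz_d n y.
  move: bB; rewrite /kriz_boundaries; case: (k) => [|k'].
    by rewrite memv0 => /eqP->; exists 0; rewrite linear0.
  by move=> /memv_imgP[y _ ->]; exists y.
pose a t := if t \in P then b (enum_rank_in (enum_valP i) t) else 0.
have := coh_free cP (a := a) (y := y); rewrite -yE => /(_ _ (enum_val i)).
rewrite /a enum_valP enum_valK_in => -> //.
pose F t := b (enum_rank_in (enum_valP i) t) *: c t.
rewrite (eq_bigr (fun t => if t \in P then F t else 0)) => [|t _]; last first.
  by case: ifP => // _; rewrite scale0r.
rewrite -big_mkcond big_enum_val; apply: eq_bigr => j _.
by rewrite /F enum_valK_in.
Qed.
End Betti.
End KrizGrading.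

Lemma coh_basis_reindex (V : vectType rat) (d : 'End(V)) (T T' : finType)
    (c : T -> V) (c' : T' -> V) (f : T' -> T) :
  bijective f -> (forall t, c' t = c (f t)) -> coh_basis d c -> coh_basis d c'.
Proof.
move=> fB c'E cP; have sumE (a : T -> rat) : \sum_t a t *: c t = \sum_t a (f t) *: c' t.
  rewrite (reindex f) /=; last exact: onW_bij.
  by apply: eq_bigr => t _; rewrite c'E.
have [g fK gK] := fB; split.
- by move=> t; rewrite c'E (coh_cycle cP).
- by move=> z /(coh_gen cP)[a [y ->]]; exists (a \o f), y; rewrite sumE.
move=> a y ay t; rewrite -(fK t); apply: (coh_free cP (a := a \o g) (y := y)).
by rewrite sumE -ay; apply: eq_bigr => t' _; rewrite /= fK.
Qed.

Lemma degreeD1 n (a : 'I_n + edge n) (S : {set 'I_n + edge n}) : a \in S ->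
  upper_degree S = ((if a is inl _ then 2 else 1) + upper_degree (S :\ a))%N /\
  #|odd_part S| = ((if a is inl _ then 0 else 1) + #|odd_part (S :\ a)|)%N.
Proof.
rewrite /upper_degree; case: a => [i|e] aS.
  have -> : #|even_part S| = #|even_part (S :\ inl i)|.+1.
    rewrite (cardsD1 i) inE aS; congr _.+1; apply: eq_card => j.
    by rewrite !inE (inj_eq inl_inj).
  have -> : odd_part (S :\ inl i) = odd_part S by apply/setP => j; rewrite !inE.
  by rewrite mulnS addnA.
have -> : #|odd_part S| = #|odd_part (S :\ inr e)|.+1.
  rewrite (cardsD1 e) inE aS; congr _.+1; apply: eq_card => j.
  by rewrite !inE (inj_eq inr_inj).
have -> : even_part (S :\ inr e) = even_part S by apply/setP => j; rewrite !inE.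
by rewrite addnS.
Qed.

Section InclusionDegree.
Variables (n : nat) (inc : {linear krizE n -> krizE n.+1}).
Hypothesis incP : point_inclusion inc.

Lemma inclusion_comp k q x : x \in kriz_comp n k q -> inc x \in kriz_comp n.+1 k q.
Proof.
have gen_comp (a : 'I_n + edge n) : inc (krizE_pi n (gen a)) \in
    kriz_comp n.+1 (if a is inl _ then 2 else 1) (if a is inl _ then 0 else 1).
  case: a => [i|e]; first by rewrite (inclusion_w incP) kriz_comp_w.
  have -> : gen (inr e) = G (val e).1 (val e).2.
    rewrite /G -surjective_pairing; case: insubP => [f _ /val_inj-> //|].
    by rewrite (valP e).
  by rewrite (inclusion_g incP) kriz_comp_g.
have mon_comp (S : {set 'I_n + edge n}) : inc (krizE_pi n (mon S)) \in
    kriz_comp n.+1 (upper_degree S) #|odd_part S|.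
  have [m] := ubnP #|S|; elim: m S => // m IH S /ltnSE Sm.
  have [->|[a aS]] := set_0Vmem S.
    by have [-> ->] := degree0 n; rewrite (inclusion1 incP) kriz_comp1.
  have {}IH := IH (S :\ a).
  rewrite (mon_genM aS) linearZ /= linearZ /= memvZ // krizE_piM (inclusionM incP).
  have [-> ->] := degreeD1 aS; apply: kriz_comp_mul (gen_comp a) (IH _).
  by rewrite (cardsD1 a S) aS in Sm.
move=> /memv_imgP[u uk ->].
have -> : inc (krizE_pi n u) = (linfun inc \o krizE_pi n)%VF u.
  by rewrite comp_lfunE [linfun _ _]lfunE.
rewrite memv_preim; apply: subvP uk; apply: krizA_compP => S <- <-.
by rewrite -memv_preim comp_lfunE [linfun _ _]lfunE.
Qed.
End InclusionDegree.

(** * Induction on the number of points *)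

Lemma krizE0_scalar (x : krizE 0) : exists a, x = a *: 1.
Proof.
elim/krizE_ind: x => u; exists (u set0).
have -> : u = u set0 *: 1.
  rewrite [LHS]gcE (big_only1 set0) // => S /eqP[].
  by apply/setP => -[[]|[[[]]]].
by rewrite linearZ /= !ffunE eqxx /GRing.scale /= mulr1.
Qed.

(** Over E(0), which consists of scalars, the free module has basis 1 and w_new; E(1) is H^*(CP^1)
    with zero differential. *)
Lemma coh_basis1 : coh_basis (kriz_d 1) (fun b : bool => if b then Ew ord0 else 1).
Proof.
have [inc incP] := point_inclusion_exists 0.
have W0 : Ew ord0 = Ew (@ord_max 0) by congr Ew; apply: val_inj.
pose asm := assemble inc (Ew (@ord_max 0)) (fun i : 'I_0 => Eg (lift ord_max i) ord_max).
have asmE a b m : asm (a *: 1, b *: 1, m) = b *: Ew ord0 + a *: 1.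
  rewrite /asm /assemble big_ord0 addr0 /= !linearZ /= (inclusion1 incP) -scalerAl mul1r.
  by rewrite addrC W0.
have gen (x : krizE 1) : exists a b, x = b *: Ew ord0 + a *: 1.
  have := assemble_coords incP x; case: (coords x) => [[y z] m].
  have [a ->] := krizE0_scalar y; have [b ->] := krizE0_scalar z => <-.
  by exists a, b; apply: asmE.
have d0 x : kriz_d 1 x = 0.
  by have [a [b ->]] := gen x; rewrite linearD !linearZ /= Ed1 Ed_w !scaler0 addr0.
split=> [t|z _|a y].
- exact: d0.
- have [a [b ->]] := gen z; exists (fun t => if t then b else a), 0.
  by rewrite d0 addr0 bool_sum.
rewrite d0 bool_sum -(asmE _ _ 0) => /(congr1 (@coords 0)).
rewrite (coords_assemble incP) coords0 => a0.
have a1 : a false *: (1 : krizE 0) = 0 := congr1 (fun p => p.1.1) a0.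
have a2 : a true *: (1 : krizE 0) = 0 := congr1 (fun p => p.1.2) a0.
have scal0 (b : rat) : b *: (1 : krizE 0) = 0 -> b = 0.
  by move=> /eqP; rewrite scaler_eq0 oner_eq0 orbF => /eqP.
by case; [exact: (scal0 _ a2)|exact: (scal0 _ a1)].
Qed.

(** With one old point there are no corrected generators (['I_0] is empty), so the second point adds
    only the acyclic summand. Geometrically, F(CP^1, 2) is homotopy equivalent to CP^1. *)
Lemma coh_basis2 : coh_basis (kriz_d 2) (fun b : bool => if b then Ew ord0 else 1).
Proof.
have [inc incP] := point_inclusion_exists 1.
have h0 (j : 'I_0) : add_h (fun=> 0) j = 0 :> krizE 1 by case: j.
have := add_coh_basis incP h0 coh_basis1.
apply: (coh_basis_reindex (f := inl)).
  by exists (fun t => match t with inl b => b | inr _ => true end) => [|[b|[[]]]].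
case; last by rewrite /= (inclusion1 incP).
by rewrite /= (inclusion_w incP); congr Ew; apply: val_inj.
Qed.

(* [b] tells whether the class is a multiple of the generator of H_1^3, and [twin] pairs a
   class with its product by that generator. *)
Record kriz_family n m (T : finType) (c : T -> krizE n) (r : T -> nat) (b : T -> bool)
    (twin : T -> T) : Prop := KrizFamily {
  family_basis : coh_basis (kriz_d n) c;
  family_comp : forall t, c t \in kriz_comp n (r t + 3 * b t) (r t + b t);
  family_twinK : involutive twin;
  family_twin_b : forall t, b (twin t) = ~~ b t;
  family_twin_r : forall t, r (twin t) = r t;
  family_r_le : forall t, (r t <= m)%N;
  family_r_onto : forall i, (i <= m)%N -> exists t, r t = i;
  family_sum : \sum_t (tvar ^+ (r t + 3 * b t) * svar ^+ (r t + b t))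
    = (1 + svar * tvar ^+ 3) * \prod_(2 <= i < m.+2) (1 + i%:R * svar * tvar) }.

(** F(CP^1, 3) is PGL_2(C), rationally a 3-sphere; its two classes have bidegrees (0, 0) and (3,
    1). *)
Lemma kriz_family3 : exists c, @kriz_family 3 0 bool c (fun=> 0%N) id negb.
Proof.
have [inc incP] := point_inclusion_exists 2.
pose h (j : 'I_1) : krizE 2 := Eg ord0 (lift ord0 j).
have parK : involutive (Epar 2) := @EparK _.
have dI x : kriz_d 3 (inc x) = inc (kriz_d 2 x) by rewrite (inclusion_d incP).
have dd X : kriz_d 3 (kriz_d 3 X) = 0 by apply: kriz_d_sqr.
(* Correcting by G_12 turns w_2 - w_1 into w_2 - w_1 - (w_1 + w_2), an exact multiple of the basis
   representative w_1 and not merely a cohomologous element, as [euler_coh_basis] requires. *)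
have hv : add_h h ord0 = - 2%:R *: Ew ord0.
  have vE (V : lmodType rat) (x y : V) : y - x - (x + y) = - 2%:R *: x.
    by rewrite scaleNr scaler_nat mulr2n opprD addrA addrAC [y - x]addrC addrK -opprD.
  rewrite /add_h (_ : kriz_d 2 (h ord0) = Ew ord0 + Ew (lift ord0 ord0)); first exact: vE.
  exact: Ed_g.
have r0 : - 2%:R != 0 :> rat by [].
have J1 (j : 'I_1) : j = ord0 by rewrite ord1.
exists (fun b => if b then inc (Ew ord0) * add_g inc h ord0 else 1); split.
- exact: (euler_coh_basis (inclusion1 incP) (inclusionM incP) parK dI (add_dM incP) dd
    (add_dG incP) (add_dg incP h) (add_gen incP h) (add_free incP (h:=h)) (@Epar1 _)
    (@Ed_leibniz _) (@Ed_par _) r0 (Epar_w ord0) (Ew_sqr ord0) J1 hv coh_basis2).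
- case; last exact: kriz_comp1.
  apply: (kriz_comp_mul (k := 2) (q := 0) (k' := 1) (q' := 1)).
    by rewrite (inclusion_w incP) kriz_comp_w.
  rewrite /add_g /shifted_g !memvB ?kriz_comp_g // (inclusion_comp incP) //.
  exact: kriz_comp_g.
- exact: negbK.
- by [].
- by [].
- by [].
- by case=> // _; exists true.
rewrite big_geq // mulr1 (bigD1 true) //= (big_only1 false) // => [|[]] //.
by rewrite !expr0 mulr1 expr1 addrC mulrC.
Qed.

Lemma diff_w_exact m (i : 'I_m.+2) : exists x : krizE m.+3,
  kriz_d m.+3 x = Ew (lift ord0 i) - Ew ord0 /\ x \in kriz_comp m.+3 1 1.
Proof.
(* A third index, different from 0 and i + 1: the last one if i = 0, otherwise 1. *)
pose k : 'I_m.+3 := lift ord0 (if i == ord0 then ord_max else ord0).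
have ki : lift ord0 i != k.
  by rewrite /k (inj_eq lift_inj); case: (eqVneq i ord0) => [->|].
exists (Eg (lift ord0 i) k - Eg ord0 k); split.
  rewrite linearB /= Ed_g // Ed_g ?neq_lift //.
  by rewrite [X in X - _]addrC [X in _ - X]addrC opprD addrACA subrr add0r.
by rewrite memvB ?kriz_comp_g.
Qed.

Lemma kriz_familyS m (T : finType) (c : T -> krizE m.+3) r b twin :
  kriz_family m c r b twin ->
  exists (T' : finType) (c' : T' -> krizE m.+4) r' b' twin', kriz_family m.+1 c' r' b' twin'.
Proof.
move=> F; have [inc incP] := point_inclusion_exists m.+3.
have /fin_all_exists[h hP] := @diff_w_exact m.
have h0 j : add_h h j = 0 by rewrite /add_h (proj1 (hP j)) subrr.
(* The old classes, and m + 2 copies of them multiplied by a corrected generator of bidegree (1, 1),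
   which raises [r] by one and keeps [b]; twins stay in the same copy. *)
exists (T + 'I_m.+2 * T)%type, (ext_class inc (add_g inc h) c).
exists (fun t => match t with inl t => r t | inr (_, t) => (r t).+1 end).
exists (fun t => match t with inl t => b t | inr (_, t) => b t end).
exists (fun t => match t with inl t => inl (twin t) | inr (j, t) => inr (j, twin t) end).
split.
- exact: (add_coh_basis incP h0 (family_basis F)).
- case=> [t|[j t]] /=; first exact: (inclusion_comp incP (family_comp F t)).
  have gc : add_g inc h j \in kriz_comp m.+4 1 1.
    rewrite /add_g /shifted_g !memvB ?kriz_comp_g //.
    exact: (inclusion_comp incP (proj2 (hP j))).
  rewrite !addSn -(addn1 (r t + 3 * b t)) -(addn1 (r t + b t)).
  exact: kriz_comp_mul (inclusion_comp incP (family_comp F t)) gc.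
- by case=> [t|[j t]]; rewrite (family_twinK F).
- by case=> [t|[j t]]; apply: (family_twin_b F).
- by case=> [t|[j t]]; rewrite (family_twin_r F).
- by case=> [t|[j t]]; rewrite ?ltnS ?leqW // (family_r_le F).
- move=> i; rewrite leq_eqVlt => /orP[/eqP->|].
    (* The new maximal value m + 1 of [r] is reached on a product with a corrected generator. *)
    by have [t <-] := family_r_onto F (leqnn m); exists (inr (ord0, t)).
  by rewrite ltnS => /(family_r_onto F)[t <-]; exists (inl t).
rewrite big_sumType /= big_nat_recr //= mulrA -(family_sum F).
pose mono t := tvar ^+ (r t + 3 * b t) * svar ^+ (r t + b t).
rewrite (eq_bigr (fun p => mono p.2 * (svar * tvar))); last first.
  by move=> [j t] _; rewrite /mono /= !addSn !exprS; ring.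
rewrite -big_distrl /= -(pair_bigA _ (fun _ => mono)) /=.
(* The m + 2 copies produce 1 + (m + 2) s t, the last factor of the new product. *)
rewrite sumr_const card_ord -mulr_natl mulrDr mulr1; congr (_ + _).
by ring.
Qed.

Lemma kriz_family_exists m : exists (T : finType) (c : T -> krizE m.+3) r b twin,
  kriz_family m c r b twin.
Proof.
elim: m => [|m [T [c [r [b [twin F]]]]]]; last exact: kriz_familyS F.
by have [c F] := kriz_family3; exists bool, c, (fun=> 0%N), id, negb.
Qed.

(** * Support, duality of Betti numbers and Poincaré polynomial *)

Section Betti.
Variables (n m : nat) (T : finType) (c : T -> krizE n) (r : T -> nat).
Variables (b : T -> bool) (twin : T -> T).
Hypothesis F : kriz_family m c r b twin.

Let deg t := ((r t + 3 * b t)%N, (r t + b t)%N).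

Lemma betti_family k q : betti n k q = #|[set t | deg t == (k, q)]|.
Proof. exact: (betti_coh_basis (deg := deg) (family_basis F) (family_comp F)). Qed.

Lemma coh_neq0 k q : (exists x : kriz_coh n k q, x != 0) <-> (0 < betti n k q)%N.
Proof.
rewrite /betti lt0n dimv_eq0 -subv0; split=> [[x]|/subvPn[x _]]; last first.
  by rewrite memv0; exists x.
by apply: contra => /subvP/(_ x); rewrite memvf memv0 => ->.
Qed.

Lemma betti_gt0 k q : (0 < betti n k q)%N <-> exists t, deg t = (k, q).
Proof.
rewrite betti_family; split=> [/card_gt0P[t]|[t tE]].
  by rewrite inE => /eqP; exists t.
by apply/card_gt0P; exists t; rewrite inE tE.
Qed.

Lemma coh_support k q : (exists x : kriz_coh n k q, x != 0) <->
  (exists2 i : nat, (i <= m)%N &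
     (k = i /\ q = i) \/ (k = (i + 3)%N /\ q = (i + 1)%N)).
Proof.
rewrite coh_neq0 betti_gt0; split=> [[t [<- <-]]|[i im kq]].
  exists (r t); first exact: (family_r_le F).
  by case: (b t); [right|left; rewrite muln0 !addn0].
have [t tE] := family_r_onto F im.
(* Exactly one of a class and its twin has [b] false; that one has bidegree (i, i), the other (i +
   3, i + 1). *)
have [s [sE sb]] : exists s, r s = i /\ b s = false.
  case bt: (b t); last by exists t.
  by exists (twin t); rewrite (family_twin_r F) (family_twin_b F) bt.
case: kq => -[-> ->]; last first.
  by exists (twin s); rewrite /deg (family_twin_r F) (family_twin_b F) sb sE.
by exists s; rewrite /deg sb sE muln0 !addn0.
Qed.

Lemma betti_twin q : betti n q q = betti n (q + 3) (q + 1).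
Proof.
rewrite !betti_family -(card_imset _ (can_inj (family_twinK F))).
congr #|pred_of_set _|; apply/setP => t.
rewrite -{1}[t]/(id t) -(family_twinK F t) mem_imset; last exact: (can_inj (family_twinK F)).
rewrite !inE /deg !xpair_eqE (family_twinK F) (family_twin_r F) (family_twin_b F).
case: (b t) => /=; rewrite ?muln0 ?muln1 ?addn0.
  by rewrite !eqn_add2r.
(* For [b t] false both conditions are absurd: one needs r + 3 = r + 1, the other q + 3 = q + 1. *)
lia.
Qed.

Lemma poincare_family : poincare n =
  \sum_t (tvar ^+ (r t + 3 * b t) * svar ^+ (r t + b t)).
Proof.
rewrite (eq_bigr (fun t => \sum_(k < degree_bound n) \sum_(q < degree_bound n)
  if deg t == (val k, val q) then tvar ^+ k * svar ^+ q else 0)) => [|t _].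
  rewrite exchange_big; apply: eq_bigr => k _; rewrite exchange_big; apply: eq_bigr => q _.
  rewrite -big_mkcond /= sumr_const betti_family -mulrA mulr_natl.
  by congr (_ *+ _); apply: eq_card => t; rewrite !inE.
(* A class makes its own Betti number positive, so by [betti_eq0] the truncation in [poincare] loses
   no class. *)
have [kb qb] : (r t + 3 * b t < degree_bound n)%N /\ (r t + b t < degree_bound n)%N.
  have : (0 < betti n (r t + 3 * b t) (r t + b t))%N by apply/betti_gt0; exists t.
  move=> bt; split; rewrite ltnNge; apply/negP => le_b; move: bt.
    by rewrite betti_eq0 ?le_b.
  by rewrite betti_eq0 ?le_b ?orbT.
rewrite (big_only1 (Ordinal kb)) => // [|k kt _]; last first.
  apply: big1 => q _; rewrite /deg xpair_eqE; case: eqP => //= kE.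
  by case/eqP: kt; apply: val_inj.
rewrite (big_only1 (Ordinal qb)) => // [|q qt _]; first by rewrite /= eqxx.
rewrite /deg xpair_eqE; case: (_ =P val q) => [qE|]; last by rewrite andbF.
by case/eqP: qt; apply: val_inj.
Qed.
End Betti.

Section EqDim.
Import VectorInternalTheory.

(** The map is the identity matrix in internal coordinates, written as [pid_mx] because the two
    dimensions are only propositionally equal. *)
Lemma eq_dim_bijective (V W : vectType rat) : \dim {:V} = \dim {:W} ->
  exists f : 'Hom(V, W), bijective f.
Proof.
rewrite !dimvf => VW.
pose iso (U U' : vectType rat) : 'Hom(U, U') :=
  linfun (r2v \o mulmxr (pid_mx (dim U) : 'M_(dim U, dim U')) \o v2r).
have isoK (U U' : vectType rat) : dim U = dim U' -> cancel (iso U U') (iso U' U).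
  move=> UU' x; rewrite !lfunE /= r2vK -mulmxA mul_pid_mx.
  by rewrite -UU' !minnn pid_mx_1 mulmx1 v2rK.
by exists (iso V W), (iso W V); apply: isoK.
Qed.
End EqDim.

Theorem theorem1p5 (n : nat) (hn : (4 <= n)%N) :
  [/\ forall k q : nat,
        (exists x : kriz_coh n k q, x != 0) <->
        (exists2 r : nat, (r <= n - 3)%N &
           (k = r /\ q = r) \/ (k = (r + 3)%N /\ q = (r + 1)%N)),
      forall q : nat, (q <= n - 3)%N ->
        exists f : 'Hom(kriz_coh n q q, kriz_coh n (q + 3) (q + 1)), bijective f
    & poincare n =
        (1 + svar * tvar ^+ 3) * \prod_(2 <= i < n.-1) (1 + i%:R * svar * tvar)].
Proof.
(* With n = m + 3, the bound n - 3 is m and [n.-1] is [m.+2], as in [family_sum]. *)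
have [m ->] : exists m, n = m.+3.
  by exists (n - 3)%N; rewrite -addn3 subnK // ltnW.
have [T [c [r [b [twin F]]]]] := kriz_family_exists m.
rewrite -addn3 addnK addn3 /=; split.
- exact: coh_support F.
- by move=> q _; apply: eq_dim_bijective; apply: (betti_twin F).
by rewrite (poincare_family F) (family_sum F).
Qed.
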